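(* Let $\mathsf r,\mathsf s$ be positive integers with $\gcd(\mathsf r,\mathsf s)=1$. (a) Let $\mathcal{H}^{mot}_{\mathsf r,\mathsf s;2}$ be the (uncolored) motivic superpolynomial of the unibranch ring $\mathcal{R}'=\mathbb{F}_q[[z^{2\mathsf r},\,z^{2\mathsf s}+u\,z^{2\mathsf s+1}]]\subset\mathbb{F}_q[[z]]$, where $u\in\mathbb{F}_q$, $u\ne0$, and the valuation semigroup of $\mathcal{R}'$ is generated by $2\mathsf r,2\mathsf s,2\mathsf r\mathsf s+1$ (i.e. the corresponding knot is the cable $Cab(2\mathsf r\mathsf s+1,2)T(\mathsf r,\mathsf s)$). (b) Let $\mathcal{H}^{mot}_{2\mathsf r,2\mathsf s}$ be the (uncolored) motivic superpolynomial of the two-branch ring $\tilde{\mathcal{R}}=\mathbb{F}_q[[\,w z_1^{\mathsf r}+z_2^{\mathsf r},\;z_1^{\mathsf s}+z_2^{\mathsf s}\,]]\subset\tilde{\mathcal{O}}=\mathbb{F}_q[[z_1]]\oplus\mathbb{F}_q[[z_2]]$, where $w\in\mathbb{F}_q$ and $w^{\mathsf s}\ne0,1$ (the link is $T(2\mathsf r,2\mathsf s)$). (c) Let $\mathcal{H}^{mot}_{\mathsf r,\mathsf s}(2)$ be the motivic superpolynomial of rank $2$ for $\mathcal{R}_\circ=\mathbb{F}_q[[z^{\mathsf r},z^{\mathsf s}]]$ acting diagonally in $\Omega=\mathbb{F}_q[[z]]\varepsilon_1\oplus\mathbb{F}_q[[z]]\varepsilon_2$ (the knot $T(\mathsf r,\mathsf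 s)$ colored by $2\omega_1$). Then $$(1+aq)\,\mathcal{H}^{mot}_{\mathsf r,\mathsf s}(2)+(q-1)\,\mathcal{H}^{mot}_{\mathsf r,\mathsf s;2}=q\,\mathcal{H}^{mot}_{2\mathsf r,2\mathsf s}.$$
   Context: All rings $\mathbb{F}_q[[x,y]]$ inside a ring $\mathcal{O}$ denote the set of all power series in the given elements $x,y$, with $1\in\mathcal{O}$. Empty products are $1$. Uncolored case. Let $\mathcal{O}=\oplus_{i=1}^{\kappa}\mathbb{F}_q[[z_i]]$ with idempotents $e_1,\dots,e_\kappa$ ($z_i=z_ie_i$, $1=\sum e_i$), $z=\sum z_i$, and let $\mathcal{R}=\mathbb{F}_q[[x,y]]\subset\mathcal{O}$ be the subring (containing $1$) of all power series in two elements $x,y\in z\mathcal{O}$, such that the total ring of fractions (localization) of $\mathcal{R}$ is $\oplus_{i=1}^{\kappa}\mathbb{F}_q((z_i))$; put $\mathfrak{m}_{\mathcal R}=\mathcal{R}\cap z\mathcal{O}$. Standard modules are $\mathcal{R}$-submodules $M\subset\mathcal{O}$ with $\mathcal{O}M=\mathcal{O}$ (finitely many). The motivic superpolynomial is $$\mathcal{H}^{mot}=\sum_{M}t^{\dim_{\mathbb{F}_q}(\mathcal{O}/M)}\prod_{j=1}^{rk_q(M)-1}(1+aq^j),\qquad rk_q(M)=\dim_{\mathbb{F}_q}(M/\mathfrak{m}_{\mathcal R}M),$$ summed over all standard $M$. In (a), $\kappa=1$; in (b), $\kappa=2$. Rank $2$ case. For $\mathcal{R}_\circ\subset\mathcal{O}=\mathbb{F}_q[[z]]$,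 $\mathfrak{m}=\mathcal{R}_\circ\cap z\mathcal{O}$, $\Omega=\mathcal{O}^{\oplus2}$, standard modules are $\mathcal{R}_\circ$-submodules $M\subset\Omega$ with $\mathcal{O}M=\Omega$, and $$\mathcal{H}^{mot}_{\mathsf r,\mathsf s}(2)=\sum_Mt^{\dim_{\mathbb{F}_q}(\Omega/M)}\prod_{j=2}^{rk_q(M)-1}(1+aq^j),\qquad rk_q(M)=\dim_{\mathbb{F}_q}(M/\mathfrak{m}M)\ge2.$$ The valuation semigroup of $\mathcal{R}'\subset\mathbb{F}_q[[z]]$ is the set of $z$-adic valuations of its nonzero elements. *)

(* Defs.v *)
From HB Require Import structures.
From mathcomp Require Import all_boot all_order all_algebra.
From mathcomp Require Import boolp classical_sets functions cardinality fsbigop.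

Set Implicit Arguments.
Unset Strict Implicit.
Unset Printing Implicit Defensive.

Import GRing.Theory.
Local Open Scope classical_set_scope.
Local Open Scope ring_scope.

Record fps (F : Type) := Fps { fcoef : nat -> F }.

HB.instance Definition _ (F : Type) := gen_eqMixin (fps F).
HB.instance Definition _ (F : Type) := gen_choiceMixin (fps F).

Section PowerSeriesAlgebra.
Variable F : fieldType.
Implicit Types f g h : fps F.

Lemma fpsP f g : fcoef f =1 fcoef g -> f = g.
Proof. by case: f g => [f] [g] /= /funext ->. Qed.

Definition fps_zero : fps F := Fps (fun=> 0).
Definition fps_opp f := Fps (fun n => - fcoef f n).
Definition fps_add f g := Fps (fun n => fcoef f n + fcoef g n).
Definition fps_one : fps F := Fps (fun n => (n == 0%N)%:R).
Definition fps_mul f g :=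
  Fps (fun n => \sum_(i < n.+1) fcoef f i * fcoef g (n - i)%N).
Definition fps_scale (c : F) f := Fps (fun n => c * fcoef f n).

Lemma fps_addA : associative fps_add.
Proof. by move=> f g h; apply: fpsP => n /=; rewrite addrA. Qed.
Lemma fps_addC : commutative fps_add.
Proof. by move=> f g; apply: fpsP => n /=; rewrite addrC. Qed.
Lemma fps_add0 : left_id fps_zero fps_add.
Proof. by move=> f; apply: fpsP => n /=; rewrite add0r. Qed.
Lemma fps_addN : left_inverse fps_zero fps_opp fps_add.
Proof. by move=> f; apply: fpsP => n /=; rewrite addNr. Qed.

HB.instance Definition _ :=
  GRing.isZmodule.Build (fps F) fps_addA fps_addC fps_add0 fps_addN.

Definition fps_trunc (N : nat) f : {poly F} := \poly_(i < N) fcoef f i.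

Lemma fcoef_mul_trunc N f g n : (n < N)%N ->
  fcoef (fps_mul f g) n = (fps_trunc N f * fps_trunc N g)`_n.
Proof.
move=> nN; rewrite coefM /=; apply: eq_bigr => i _.
by rewrite !coef_poly (leq_trans (ltn_ord i) nN) (leq_ltn_trans (leq_subr i n) nN).
Qed.

Lemma coef_mul_trunc N (p p' r r' : {poly F}) n : (n < N)%N ->
  (forall i, (i < N)%N -> p`_i = p'`_i) -> (forall i, (i < N)%N -> r`_i = r'`_i) ->
  (p * r)`_n = (p' * r')`_n.
Proof.
move=> nN pp' rr'; rewrite !coefM; apply: eq_bigr => i _.
by rewrite (pp' _ (leq_trans (ltn_ord i) nN)) (rr' _ (leq_ltn_trans (leq_subr i n) nN)).
Qed.

Lemma fps_mulA : associative fps_mul.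
Proof.
move=> f g h; apply: fpsP => n; rewrite !(fcoef_mul_trunc _ _ (ltnSn n)).
have tr a b i : (i < n.+1)%N ->
    (fps_trunc n.+1 (fps_mul a b))`_i = (fps_trunc n.+1 a * fps_trunc n.+1 b)`_i.
  by move=> lei; rewrite -fcoef_mul_trunc // coef_poly lei.
rewrite (coef_mul_trunc (ltnSn n) (fun _ _ => erefl) (tr g h)) mulrA.
by rewrite (coef_mul_trunc (ltnSn n) (tr f g) (fun _ _ => erefl)).
Qed.

Lemma fps_mulC : commutative fps_mul.
Proof.
by move=> f g; apply: fpsP => n; rewrite !(fcoef_mul_trunc _ _ (ltnSn n)) mulrC.
Qed.

Lemma fps_mul1 : left_id fps_one fps_mul.
Proof.
move=> f; apply: fpsP => n /=; rewrite big_ord_recl /= mul1r subn0 big1 ?addr0 //.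
by move=> i _; rewrite mul0r.
Qed.

Lemma fps_mulDl : left_distributive fps_mul fps_add.
Proof.
move=> f g h; apply: fpsP => n /=; rewrite -big_split /=.
by apply: eq_bigr => i _; rewrite mulrDl.
Qed.

Lemma fps_one_neq0 : fps_one != 0 :> fps F.
Proof.
by apply/eqP => /(congr1 (fun f => fcoef f 0)) /eqP; rewrite /= oner_eq0.
Qed.

HB.instance Definition _ := GRing.Zmodule_isComNzRing.Build (fps F)
  fps_mulA fps_mulC fps_mul1 fps_mulDl fps_one_neq0.

Lemma fps_scaleA a b f : fps_scale a (fps_scale b f) = fps_scale (a * b) f.
Proof. by apply: fpsP => n /=; rewrite mulrA. Qed.
Lemma fps_scale1 : left_id 1 fps_scale.
Proof. by move=> f; apply: fpsP => n /=; rewrite mul1r. Qed.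
Lemma fps_scaleDr : right_distributive fps_scale +%R.
Proof. by move=> a f g; apply: fpsP => n /=; rewrite mulrDr. Qed.
Lemma fps_scaleDl f : {morph fps_scale^~ f : a b / a + b}.
Proof. by move=> a b; apply: fpsP => n /=; rewrite mulrDl. Qed.

HB.instance Definition _ := GRing.Zmodule_isLmodule.Build F (fps F)
  fps_scaleA fps_scale1 fps_scaleDr fps_scaleDl.

Lemma fps_scaleAl (a : F) f g : a *: (f * g) = (a *: f) * g.
Proof.
apply: fpsP => n /=; rewrite mulr_sumr.
by apply: eq_bigr => i _; rewrite mulrA.
Qed.

HB.instance Definition _ := GRing.Lmodule_isLalgebra.Build F (fps F) fps_scaleAl.
HB.instance Definition _ := GRing.Lalgebra_isComAlgebra.Build F (fps F).

Definition fpsX : fps F := Fps (fun n => (n == 1%N)%:R).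

Definition has_valuation f (n : nat) :=
  fcoef f n <> 0 /\ forall i, (i < n)%N -> fcoef f i = 0.

Definition valuation_semigroup (R : set (fps F)) : set nat :=
  [set n | exists2 f, R f & has_valuation f n].

End PowerSeriesAlgebra.

Definition generated_semigroup3 (a b c : nat) : set nat :=
  [set n | exists i j k, n = (i * a + j * b + k * c)%N].

(* The normalization ring is any commutative [F]-algebra [O] with a
   distinguished element [z] (for several branches, [z] is the sum of the
   uniformizers), and [Om] is the ambient [O]-module. *)

Section Motivic.
Variables (F : finFieldType) (O : comAlgType F) (z : O).

(* The subring F[[x, y]] of O: all sums of power series in x and y, where the
   double series is the limit of its partial sums in the z-adic topology. *)
Definition power_series_ring (x y : O) : set O :=
  [set f | exists c : nat -> nat -> F, forall k, exists N0, forall N,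
     (N0 <= N)%N -> exists g,
       f - \sum_(i < N) \sum_(j < N) c i j *: (x ^+ i * y ^+ j) = z ^+ k * g].

Definition max_ideal (R : set O) : set O := R `&` range ( *%R z).

Variable Om : lmodType O.
Implicit Types (R I : set O) (M U V : set Om).

Definition submodule R M :=
  [/\ M 0, forall u v, M u -> M v -> M (u + v)
    & forall f v, R f -> M v -> M (f *: v)].

(* The additive group generated by the products f *: v, f in I, v in M. *)
Definition module_prod I M : set Om :=
  [set v | exists n (f : 'I_n -> O) (m : 'I_n -> Om),
     [/\ forall i, I (f i), forall i, M (m i) & v = \sum_(i < n) f i *: m i]].

Definition standard_module R M :=
  submodule R M /\ module_prod setT M = setT.

(* [F] acts on [Om] through the scalars [c%:A] of the F-algebra [O]. *)
Definition basis_mod U V n (e : 'I_n -> Om) :=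
  [/\ forall i, U (e i),
      forall u, U u -> exists c : 'I_n -> F, V (u - \sum_(i < n) (c i)%:A *: e i)
    & forall c : 'I_n -> F, V (\sum_(i < n) (c i)%:A *: e i) -> forall i, c i = 0].

(* dim_F (U / V) for V contained in U; the default 0 is used only when the
   quotient is infinite-dimensional. *)
Definition quot_dim U V : nat :=
  xget 0%N [set n | exists e : 'I_n -> Om, basis_mod U V e].

Definition rkq R M : nat := quot_dim M (module_prod (max_ideal R) M).

End Motivic.

(* Superpolynomials live in Z[a][t]. *)
Definition varA : {poly {poly int}} := 'X%:P.
Definition varT : {poly {poly int}} := 'X.
Definition qpol (F : finFieldType) : {poly {poly int}} := #|F|%:R.

(* [c] is the rank of [Om] over [O]: 1 in the uncolored case ([Om] = [O]), and
   2 for [Om] = [O] (+) [O]. The finitely supported sum is the sum over all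
   standard modules, as there are finitely many and every summand is nonzero
   (its coefficient of a^0 is a power of t). *)
Definition Hmot (F : finFieldType) (O : comAlgType F) (z : O) (Om : lmodType O)
    (c : nat) (R : set O) : {poly {poly int}} :=
  \sum_(M \in [set M : set Om | standard_module R M])
     (varT ^+ quot_dim (F := F) [set: Om] M *
      \prod_(c <= j < rkq z R M) (1 + varA * qpol F ^+ j)).

Section Rings.
Variable F : finFieldType.

Definition cable_ring (r s : nat) (u : F) : set (fps F) :=
  power_series_ring (fpsX F) (fpsX F ^+ (2 * r))
    (fpsX F ^+ (2 * s) + u *: fpsX F ^+ (2 * s).+1).

Definition torus_ring (r s : nat) : set (fps F) :=
  power_series_ring (fpsX F) (fpsX F ^+ r) (fpsX F ^+ s).

Definition fps2 : comAlgType F := (fps F * fps F)%type.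
Definition fps2X : fps2 := (fpsX F, fpsX F).

Definition link_ring (r s : nat) (w : F) : set fps2 :=
  power_series_ring fps2X (w *: fpsX F ^+ r, fpsX F ^+ r)
    (fpsX F ^+ s, fpsX F ^+ s).

Definition Hmot_cable (r s : nat) (u : F) : {poly {poly int}} :=
  Hmot (fpsX F) (fps F)^o 1 (cable_ring r s u).

Definition Hmot_link (r s : nat) (w : F) : {poly {poly int}} :=
  Hmot fps2X fps2^o 1 (link_ring r s w).

Definition Hmot_rank2 (r s : nat) : {poly {poly int}} :=
  Hmot (fpsX F) ((fps F)^o * (fps F)^o)%type 2 (torus_ring r s).

End Rings.

(* Main.v *)
Require Import Defs.
From HB Require Import structures.
From mathcomp Require Import all_boot all_order all_algebra.
From mathcomp Require Import zify ring.

Set Implicit Arguments.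
Unset Strict Implicit.
Unset Printing Implicit Defensive.

Import GRing.Theory.

(** Write [q = #|F|]. The three rings act on a free module [Om] of rank two over
    power series in [zeta], where [zeta] is [z ^ 2] for the cable and [z] in the
    other two cases: in suitable coordinates [X] acts as [zeta ^ r * g] and [Y] as
    [zeta ^ s * h] up to higher order, for commuting invertible matrices [g] and
    [h] of size two. They are [1] and a shear for the cable, a diagonal matrix
    and [1] for the link, and [1] and [1] in rank two. A standard module [M] is
    sorted by its reduction [L], the image of [M] in [Om / zeta Om = F ^ 2]. It can
    be any line except one for the cable, any line except two for the link, and
    in all cases it can be the whole of [F ^ 2], the only possibility in rank two.

    The key point is that the contribution [A] of the modules with [L = F ^ 2], and
    the contribution [B] of the modules with [L] a fixed line [l], do not depend on
    the ring, provided that [l] is not an eigenline of [g ^ s * h ^ (- r)]. Since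
    the rank-two normalization omits one factor, this gives

      (1 + a q) H(2) = A,    H(cable) = A + q B,    H(link) = A + (q - 1) B,

    whence the identity, as [A + (q - 1) (A + q B) = q (A + (q - 1) B)]. The
    eigenline condition reads [r u <> 0] for the cable, which the hypothesis on
    the semigroup provides ([cable_not_divisor]), and [w ^ s <> 1] for the link.

    To see that [A] and [B] do not depend on the ring, count the pairs [(m, M)]
    where [m] is a frame, a family of [k] elements of [M] lifting a basis of [L],
    with [k = 2] for [A] and [k = 1] for [B]. The number of frames in [M] is
    determined by the codimension of [M]. For a fixed frame, let [Om(L)] be the
    preimage of [L] and [N] the submodule generated by [m]; the modules [M]
    correspond to the submodules of [Om(L) / N]. This quotient is dual to
    [(F[X, Y] / J) ^ k], where [J] is spanned by the monomials [X^a Y^b] of weight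
    [a r + b s] at least [D = k' r s - r - s], with [k' = 1] for [A] and [k' = 2]
    for [B]; in particular it is the same for all frames and all rings. The
    duality sends [v] to the function [(a, b) |-> lam (X^a Y^b v)], for a suitable
    functional [lam] on [Om] that vanishes on [N] and on the degrees above [D]
    ([duality_parametrization]). That it is well defined and bijective comes down
    to linear algebra in the layers [zeta ^ i Om / zeta ^ (i + 1) Om], with the
    symmetry between represented numbers and gaps of the semigroup generated by
    [r] and [s] ([full_layer_duality], [line_layer_duality]). The codimension of
    [M] and its number of generators exceed those of the corresponding submodule
    by [2 - k] and [k], so the sum over [M] becomes a sum over submodules of a
    fixed finite module ([sum_over_heads]).

    The standard modules contain a fixed power of [zeta], because the rings contain
    a conductor ideal; this replaces [Om] by a finite quotient
    ([Hmot_transport]). *)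

(** * Representations of integers by two coprime numbers *)

Section Representations.
Variables r s : nat.
Hypotheses (r_gt0 : 0 < r) (s_gt0 : 0 < s) (co_rs : coprime r s).

Lemma rep_canonical a b :
  exists a0 b0, [/\ a0 < s, a0 * r + b0 * s = a * r + b * s & b <= b0].
Proof.
exists (a %% s), (b + (a %/ s) * r); rewrite ltn_pmod ?leq_addr //; split=> //.
by rewrite [in RHS](divn_eq a s); nia.
Qed.

(** Coprimality makes [(s, - r)] generate the relations between two
    representations of the same number. *)
Lemma rep_step a b a0 b0 : a0 < s -> a0 * r + b0 * s = a * r + b * s ->
  exists k, a = a0 + k * s /\ b0 = b + k * r.
Proof.
move=> a0s E.
have le_a : a0 <= a.
  rewrite leqNgt; apply/negP => lt_a.
  have E1 : (a0 - a) * r + b0 * s = b * s by rewrite mulnBl; nia.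
  have : s %| (a0 - a) * r by rewrite -(dvdn_addl _ (dvdn_mull b0 (dvdnn s))) E1 dvdn_mull.
  rewrite Gauss_dvdl 1?coprime_sym // => /dvdn_leq; lia.
have E1 : b0 * s = (a - a0) * r + b * s by rewrite mulnBl; nia.
have : s %| (a - a0) * r by rewrite -(dvdn_addl _ (dvdn_mull b (dvdnn s))) -E1 dvdn_mull.
rewrite Gauss_dvdl 1?coprime_sym // => /dvdnP[k ka]; exists k; split; first by lia.
have: b0 * s = (b + k * r) * s by rewrite E1 ka; lia.
by move/eqP; rewrite eqn_pmul2r // => /eqP.
Qed.

Lemma rep_unique a b a' b' : a * r + b * s = a' * r + b' * s ->
  a * r + b * s < r * s -> a = a' /\ b = b'.
Proof.
move=> E lt; have as_ : a < s by nia.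
have [k [Ea Eb]] := rep_step as_ E.
case: k Ea Eb => [|k] Ea Eb; first by rewrite Ea Eb !mul0n !addn0.
rewrite Eb in lt.
by have := leq_mul (leq_addr (k * r + b') r) (leqnn s); nia.
Qed.

Lemma rep_at_most_two a b a0 b0 : a0 < s -> a0 * r + b0 * s = a * r + b * s ->
  a0 * r + b0 * s < 2 * r * s -> (a = a0 /\ b = b0) \/ (a = a0 + s /\ b0 = b + r).
Proof.
move=> a0s E lt; have [k [Ea Eb]] := rep_step a0s E.
case: k Ea Eb => [|[|k]] Ea Eb; [left; lia | right; lia |].
by have := leq_mul (leq_addr (k * r + b) (2 * r)) (leqnn s); rewrite Eb in E lt; nia.
Qed.

(** The multiple [a * r] of [r] with [a < s] congruent to [i] modulo [s] either is
    at most [i], which represents [i], or overshoots [i] by a multiple of [s]; the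
    second case is Sylvester's description of the gaps of the semigroup generated
    by [r] and [s]. *)
Lemma gap_or_rep i : (exists a b, a * r + b * s = i) \/
  (exists a b, i + a.+1 * r + b.+1 * s = r * s).
Proof.
have [u [v Euv]] : exists u v, u * r = v * s + 1.
  case: (egcdnP s r_gt0) => u v E _; exists u, v.
  by rewrite E addnC (eqP co_rs) addnC.
pose a := (i * u) %% s.
have as_ : a < s by rewrite ltn_pmod.
have cong : a * r = i %[mod s].
  by rewrite modnMml -mulnA Euv mulnDr muln1 mulnA modnMDl.
case: (leqP (a * r) i) => le; [left | right].
  have /dvdnP[b Eb] : s %| i - a * r by rewrite -eqn_mod_dvd //; apply/eqP.
  by exists a, b; rewrite -Eb subnKC.
have /dvdnP[b Eb] : s %| a * r - i.
  by rewrite -eqn_mod_dvd ?(ltnW le) //; apply/eqP.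
case: b Eb => [|b] Eb; first by rewrite mul0n in Eb; lia.
exists (s - a.+1), b; rewrite subnSK // mulnBl.
have le2 : a * r <= s * r by rewrite leq_mul2r (ltnW as_) orbT.
by rewrite -Eb; lia.
Qed.

Lemma gap_not_rep i a b : i + a.+1 * r + b.+1 * s = r * s ->
  forall a' b', a' * r + b' * s <> i.
Proof.
move=> E a' b' Ei.
have E0 : 0 * r + r * s = (a' + a.+1) * r + (b' + b.+1) * s by rewrite mul0n -E -Ei; lia.
have [k [Ea Eb]] := rep_step s_gt0 E0.
case: k Ea Eb => [|k] Ea Eb; [lia | nia].
Qed.

End Representations.

(** * Subspaces of finite vector spaces *)

Local Open Scope ring_scope.

Section FiniteSubspaces.
Variable F : finFieldType.

Section Subspace.
Variable E : finLmodType F.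
Implicit Types (M U V : {set E}) (u v : E).

Definition subspace M : bool :=
  (0 \in M) && [forall c : F, [forall u in M, [forall v in M, c *: u + v \in M]]].

Lemma subspaceP M :
  reflect (0 \in M /\ forall c u v, u \in M -> v \in M -> c *: u + v \in M) (subspace M).
Proof.
apply: (iffP andP) => -[M0 H]; split=> //.
  by move=> c u v Mu Mv; move/forallP/(_ c)/forall_inP/(_ u Mu)/forall_inP/(_ v Mv): H.
by apply/forallP => c; apply/forall_inP => u Mu; apply/forall_inP => v Mv; apply: H.
Qed.

Lemma subspace0 M : subspace M -> 0 \in M. Proof. by case/subspaceP. Qed.

Lemma subspaceD M u v : subspace M -> u \in M -> v \in M -> u + v \in M.
Proof. by case/subspaceP=> _ H Mu Mv; rewrite -[u]scale1r H. Qed.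

Lemma subspaceZ M c u : subspace M -> u \in M -> c *: u \in M.
Proof. by case/subspaceP=> M0 H Mu; rewrite -[_ *: _]addr0 H. Qed.

Lemma subspaceN M u : subspace M -> u \in M -> - u \in M.
Proof. by move=> sM; rewrite -scaleN1r; apply: subspaceZ. Qed.

Lemma subspaceB M u v : subspace M -> u \in M -> v \in M -> u - v \in M.
Proof. by move=> sM Mu Mv; rewrite subspaceD ?subspaceN. Qed.

Lemma subspace_sum M (I : Type) (r : seq I) (P : pred I) (f : I -> E) :
  subspace M -> (forall i, P i -> f i \in M) -> \sum_(i <- r | P i) f i \in M.
Proof.
move=> sM Mf; elim/big_ind: _ => [|u v Mu Mv|//]; first exact: subspace0.
exact: subspaceD.
Qed.

Lemma subspace_gt0 M : subspace M -> (0 < #|M|)%N.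
Proof. by move=> sM; apply/card_gt0P; exists 0; apply: subspace0. Qed.

Lemma subspaceT : subspace setT.
Proof. by apply/subspaceP; split=> *; rewrite inE. Qed.

Lemma subspaceI U V :
  subspace U -> subspace V -> subspace (U :&: V).
Proof.
case/subspaceP=> U0 HU /subspaceP[V0 HV]; apply/subspaceP.
rewrite !inE U0 V0; split=> // c u v; rewrite !inE => /andP[? ?] /andP[? ?].
by rewrite HU ?HV.
Qed.

(** The dimension of [U / V]. Cardinals make the computations of dimensions below
    multiplicative identities; the logarithm is exact by [card_subspace]. *)
Definition ldim U V : nat := trunc_log #|F| (#|U| %/ #|V|).

Lemma card_field_gt1 : (1 < #|F|)%N. Proof. exact: card_finRing_gt1. Qed.

Lemma ldimE U V d : (0 < #|V|)%N -> #|U| = (#|V| * #|F| ^ d)%N -> ldim U V = d.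
Proof. by move=> V0 H; rewrite /ldim H mulKn // trunc_expnK // card_field_gt1. Qed.

Lemma card_basis U V n (e : 'I_n -> E) :
  subspace U -> subspace V -> V \subset U ->
  (forall i, e i \in U) ->
  (forall u, u \in U -> exists c : 'I_n -> F, u - \sum_i c i *: e i \in V) ->
  (forall c : 'I_n -> F, \sum_i c i *: e i \in V -> forall i, c i = 0) ->
  #|U| = (#|V| * #|F| ^ n)%N.
Proof.
move=> sU sV VU eU eS eF.
pose f (p : E * {ffun 'I_n -> F}) := p.1 + \sum_i p.2 i *: e i.
have -> : U = f @: setX V setT.
  apply/setP=> u; apply/idP/imsetP => [Uu | [[v c]]].
    have [c Vc] := eS u Uu; exists (u - \sum_i c i *: e i, [ffun i => c i]).
      by rewrite !inE Vc.
    rewrite /f /= -[LHS](subrK (\sum_i c i *: e i)); congr (_ + _).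
    by apply: eq_bigr => i _; rewrite ffunE.
  rewrite !inE andbT /f /= => Vv ->; rewrite (subspaceD sU (subsetP VU _ Vv)) //.
  by apply: subspace_sum => // i _; rewrite subspaceZ.
rewrite card_in_imset ?cardsX ?cardsT ?card_ffun ?card_ord //.
move=> [v c] [v' c']; rewrite !inE !andbT /f /= => Vv Vv' Ef.
have Ec : c = c'.
  apply/ffunP=> i; apply/eqP; rewrite -subr_eq0; apply/eqP.
  apply: (eF (fun i => c i - c' i)) => {i}.
  have -> : \sum_i (c i - c' i) *: e i = v' - v.
    under eq_bigr do rewrite scalerBl.
    by rewrite sumrB -[v'](addrK (\sum_i c' i *: e i)) -Ef addrAC [v + _]addrC addrK.
  exact: subspaceB.
by rewrite -Ec in Ef *; move/addIr: Ef => ->.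
Qed.

Lemma subspace_basis U V : subspace U -> subspace V -> V \subset U ->
  exists n (e : 'I_n -> E),
  [/\ forall i, e i \in U,
      forall u, u \in U -> exists c : 'I_n -> F, u - \sum_i c i *: e i \in V
    & forall c : 'I_n -> F, \sum_i c i *: e i \in V -> forall i, c i = 0].
Proof.
move=> sU; have [k] := ubnP #|U :\: V|; elim: k V => // k IH V ltk sV VU.
have [UV | /subsetPn[u Uu nVu]] := boolP (U \subset V).
  exists 0%N, (fun _ => 0); split=> [[]//|u Uu|c _ []//].
  by exists (fun _ => 0); rewrite big_ord0 subr0 (subsetP UV).
pose W := [set p.1 + p.2 *: u | p in setX V setT].
have memW w c : w + c *: u \in V -> w \in W.
  move=> h; apply/imsetP; exists (w + c *: u, - c); first by rewrite !inE h.
  by rewrite /= scaleNr addrK.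
have W_V w : w \in W -> exists c, w + c *: u \in V.
  case/imsetP=> -[v c]; rewrite !inE andbT /= => Vv ->; exists (- c).
  by rewrite scaleNr addrK.
have sW : subspace W.
  apply/subspaceP; split=> [|c w w' /W_V[a Va] /W_V[b Vb]].
    by apply: (@memW _ 0); rewrite scale0r addr0 subspace0.
  apply: (@memW _ (c * a + b)).
  rewrite scalerDl -scalerA addrACA -scalerDr subspaceD ?subspaceZ //.
have WU : W \subset U.
  apply/subsetP=> w /W_V[c Vc]; rewrite -[w](addrK (c *: u)).
  by rewrite subspaceB ?subspaceZ // (subsetP VU).
have VW : V \subset W.
  by apply/subsetP => v Vv; apply: (@memW _ 0); rewrite scale0r addr0.
have ltW : (#|U :\: W| < k)%N.
  rewrite -ltnS; apply: leq_trans ltk; rewrite ltnS; apply: proper_card; apply/properP; split.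
    exact: setDS.
  exists u; rewrite !inE ?nVu ?Uu //= andbT negbK.
  by apply: (@memW _ (-1)); rewrite scaleN1r subrr subspace0.
have [n [e [eU eS eF]]] := IH W ltW sW WU.
pose e' (i : 'I_n.+1) := if unlift ord0 i is Some j then e j else u.
have sum_e' (c : 'I_n.+1 -> F) :
    \sum_i c i *: e' i = c ord0 *: u + \sum_j c (lift ord0 j) *: e j.
  rewrite big_ord_recl /e' unlift_none; congr (_ + _).
  by apply: eq_bigr => j _; rewrite liftK.
exists n.+1, e'; split=> [i|v Uv|c Vc].
- by rewrite /e'; case: unlift.
- have [c /W_V[a Va]] := eS v Uv.
  exists (fun i => if unlift ord0 i is Some j then c j else - a).
  rewrite sum_e' unlift_none scaleNr.
  rewrite (eq_bigr (fun j => c j *: e j)); last by move=> j _; rewrite liftK.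
  by rewrite opprD opprK addrCA addrC.
- rewrite sum_e' addrC in Vc.
  have c0 j : c (lift ord0 j) = 0 by apply: (eF (fun j => c (lift ord0 j))); apply: memW Vc.
  move=> i; case: (unliftP ord0 i) => [j ->|->]; first exact: c0.
  apply/eqP; apply: contraR nVu => nz.
  rewrite big1 ?add0r in Vc; last by move=> j _; rewrite c0 scale0r.
  by rewrite -[u]scale1r -(mulVf nz) -scalerA subspaceZ.
Qed.

Lemma card_subspace U V : subspace U -> subspace V -> V \subset U ->
  #|U| = (#|V| * #|F| ^ ldim U V)%N.
Proof.
move=> sU sV VU; have [n [e [eU eS eF]]] := subspace_basis sU sV VU.
have H := card_basis sU sV VU eU eS eF.
by rewrite (ldimE (subspace_gt0 sV) H).
Qed.

End Subspace.

Section LinearImage.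
Variables (E K : finLmodType F) (f : {linear E -> K}).

Lemma subspace_preim (U : {set K}) : subspace U -> subspace (f @^-1: U).
Proof.
case/subspaceP=> U0 H; apply/subspaceP; rewrite !inE linear0; split=> // c u v.
by rewrite !inE linearP => *; apply: H.
Qed.

Lemma subspace_imset (M : {set E}) : subspace M -> subspace (f @: M).
Proof.
case/subspaceP=> M0 H; apply/subspaceP; split.
  by apply/imsetP; exists 0; rewrite ?linear0.
move=> c _ _ /imsetP[u Mu ->] /imsetP[v Mv ->].
by apply/imsetP; exists (c *: u + v); rewrite ?linearP ?H.
Qed.

Lemma card_fiber (M : {set E}) w : subspace M -> w \in M ->
  #|[set v in M | f v == f w]| = #|[set v in M | f v == 0]|.
Proof.
move=> sM Mw; rewrite -[RHS](card_imset _ (addrI w)); apply: eq_card => v.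
rewrite !inE; apply/andP/imsetP => [[Mv /eqP fv] | [u]].
  exists (v - w); last by rewrite addrC subrK.
  by rewrite inE subspaceB // linearB fv subrr /=.
by rewrite inE => /andP[Mu /eqP fu] ->; rewrite subspaceD // linearD fu addr0.
Qed.

Lemma card_rank_nullity (M : {set E}) : subspace M ->
  #|M| = (#|f @: M| * #|[set v in M | f v == 0%R]|)%N.
Proof.
move=> sM; rewrite -sum1_card (partition_big_imset f) /=.
rewrite (eq_bigr (fun=> #|[set v in M | f v == 0%R]|)) ?sum_nat_const //.
by move=> _ /imsetP[w Mw ->]; rewrite -(card_fiber sM Mw) -sum1dep_card.
Qed.

End LinearImage.
End FiniteSubspaces.

(** * Counting submodules by their frames *)

Section Submodules.
Variables (F : finFieldType) (E : finLmodType F).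
Implicit Types (M : {set E}) (x y : {linear E -> E}).

Definition xy_submodule x y M : bool :=
  [&& subspace M, x @: M \subset M & y @: M \subset M].

Lemma xy_submoduleP x y M : reflect
  [/\ subspace M, forall v, v \in M -> x v \in M & forall v, v \in M -> y v \in M]
  (xy_submodule x y M).
Proof.
apply: (iffP and3P) => -[sM Mx My]; split=> //.
- by move=> v Mv; apply: (subsetP Mx); apply: imset_f.
- by move=> v Mv; apply: (subsetP My); apply: imset_f.
- by apply/subsetP => _ /imsetP[v Mv ->]; apply: Mx.
- by apply/subsetP => _ /imsetP[v Mv ->]; apply: My.
Qed.

(** The product of [M] with the ideal generated by the two operators. *)
Definition xy_product x y M : {set E} := [set x p.1 + y p.2 | p in setX M M].

Lemma xy_productP x y M v : reflect (exists v1 v2, [/\ v1 \in M, v2 \in M & v = x v1 + y v2])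
  (v \in xy_product x y M).
Proof.
apply: (iffP imsetP) => [[[v1 v2]] | [v1 [v2 [M1 M2 ->]]]].
  by rewrite inE /= => /andP[M1 M2] ->; exists v1, v2.
by exists (v1, v2); rewrite ?inE ?M1.
Qed.

Lemma xy_product_subspace x y M : subspace M -> subspace (xy_product x y M).
Proof.
move=> sM; apply/subspaceP; split.
  by apply/xy_productP; exists 0, 0; rewrite !linear0 addr0 subspace0.
move=> c _ _ /xy_productP[u1 [u2 [? ? ->]]] /xy_productP[v1 [v2 [? ? ->]]].
apply/xy_productP; exists (c *: u1 + v1), (c *: u2 + v2).
by split; rewrite ?(subspaceD sM) ?subspaceZ // !linearP scalerDr addrACA.
Qed.

Lemma xy_product_sub x y M : xy_submodule x y M -> xy_product x y M \subset M.
Proof.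
case/xy_submoduleP=> sM Mx My; apply/subsetP => _ /xy_productP[v1 [v2 [? ? ->]]].
by rewrite subspaceD ?Mx ?My.
Qed.

Lemma xy_product_mull x y M v : subspace M -> v \in M -> x v \in xy_product x y M.
Proof.
by move=> sM Mv; apply/xy_productP; exists v, 0; rewrite linear0 addr0 subspace0.
Qed.

Lemma xy_product_mulr x y M v : subspace M -> v \in M -> y v \in xy_product x y M.
Proof.
by move=> sM Mv; apply/xy_productP; exists 0, v; rewrite linear0 add0r subspace0.
Qed.

End Submodules.

(** The value of the sums of [sum_over_heads]. It only involves the finite module
    [K]; this is why sums attached to different rings can be compared. *)
Definition quotient_sum (F : finFieldType) (K : finLmodType F) (xK yK : {linear K -> K})
    (R : nzRingType) (k : nat) (w : nat -> nat -> R) : R :=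
  \sum_(U : {set K} | xy_submodule xK yK U)
     w (ldim setT U + (2 - k))%N (ldim U (xy_product xK yK U) + k)%N *+ #|F| ^ (k * ldim setT U).

Section Counting.
Variables (F : finFieldType) (E K : finLmodType F).
Variables (x y : {linear E -> E}) (xK yK : {linear K -> K}).
Variables (hd : {linear E -> 'rV[F]_2}) (k : nat) (e : 'M[F]_(k, 2)).
Hypotheses (hd_onto : forall w, exists v, hd v = w).
Hypotheses (hdx : forall v, hd (x v) = 0) (hdy : forall v, hd (y v) = 0).
Hypotheses (k_le2 : (k <= 2)%N) (e_free : forall c : 'rV_k, c *m e = 0 -> c = 0).

Let q := #|F|.
Let q_gt0 : (0 < q)%N. Proof. exact: ltnW (card_field_gt1 F). Qed.
Let L : {set 'rV[F]_2} := [set c *m e | c : 'rV_k].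
Let E1 : {set E} := [set v | hd v == 0].

(** A frame lifts the rows of [e] to elements of [E]; a submodule with image [L]
    contains frames, and their number depends only on its codimension. *)
Definition frame (m : {ffun 'I_k -> E}) := [forall j, hd (m j) == row j e].
Definition comb (m : {ffun 'I_k -> E}) (c : 'rV_k) : E := \sum_j c 0 j *: m j.

(** On the preimage of [L], the kernel of [Phi] is the smallest submodule that
    contains [m]. Hence the submodules with image [L] that contain [m] are the
    preimages, in the preimage of [L], of the submodules of [K]. *)
Record parametrization (m : {ffun 'I_k -> E}) (Phi : {linear E -> K}) : Prop := {
  par_frame : forall j, Phi (m j) = 0;
  par_x : forall v, hd v \in L -> Phi (x v) = xK (Phi v);
  par_y : forall v, hd v \in L -> Phi (y v) = yK (Phi v);
  par_onto : forall kap, exists2 v, hd v \in L & Phi v = kap;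
  par_ker : forall v, hd v \in L -> Phi v = 0 ->
    forall M, xy_submodule x y M -> (forall j, m j \in M) -> v \in M }.

Lemma head_comb m c : frame m -> hd (comb m c) = c *m e.
Proof.
move/forallP=> hm; rewrite linear_sum mulmx_sum_row; apply: eq_bigr => j _.
by rewrite linearZ /= (eqP (hm j)).
Qed.

Lemma subspaceL : subspace L.
Proof.
apply/subspaceP; split; first by apply/imsetP; exists 0; rewrite ?mul0mx.
move=> a _ _ /imsetP[c _ ->] /imsetP[c' _ ->]; apply/imsetP; exists (a *: c + c') => //.
by rewrite mulmxDl scalemxAl.
Qed.

Lemma memL c : c *m e \in L.
Proof. exact: imset_f. Qed.

Lemma cardL : #|L| = (q ^ k)%N.
Proof.
rewrite card_imset ?card_mx ?mul1n // => c c' /eqP.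
by rewrite -subr_eq0 -mulmxBl => /eqP/e_free/eqP; rewrite subr_eq0 => /eqP.
Qed.

Lemma cardE : #|[set: E]| = (q ^ 2 * #|E1|)%N.
Proof.
rewrite (card_rank_nullity hd (subspaceT E)).
have -> : hd @: setT = setT.
  by apply/setP=> w; rewrite inE; apply/imsetP; have [v <-] := hd_onto w; exists v.
by rewrite cardsT card_mx mul1n; congr (_ * _)%N; apply: eq_card => v; rewrite !inE.
Qed.

Lemma card_over_L M : subspace M -> hd @: M = L -> #|M| = (q ^ k * #|M :&: E1|)%N.
Proof.
move=> sM hM; rewrite (card_rank_nullity hd sM) hM cardL; congr (_ * _)%N.
by apply: eq_card => v; rewrite !inE.
Qed.

Lemma codim_ge M : subspace M -> hd @: M = L ->
  (2 - k <= ldim setT M)%N /\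
  (#|M :&: E1| * q ^ (ldim setT M - (2 - k)) = #|E1|)%N.
Proof.
move=> sM hM; have cM := card_over_L sM hM.
have cE := card_subspace (subspaceT E) sM (subsetT M).
set d := ldim _ _ in cE *; rewrite cardE cM -/q in cE.
have pos : (0 < #|M :&: E1|)%N.
  by apply/card_gt0P; exists 0; rewrite !inE subspace0 // linear0 /=.
have le1 : (#|M :&: E1| <= #|E1|)%N by rewrite subset_leq_card // subsetIr.
have q1 : (1 < q)%N := card_field_gt1 F.
have led : (2 <= d + k)%N.
  rewrite -(leq_exp2l _ _ q1) -(leq_pmul2r pos) expnD.
  by apply: leq_trans (leq_mul (leqnn _) le1) _; rewrite cE; lia.
split; first by lia.
have q2 : (0 < q ^ 2)%N by rewrite expn_gt0 q_gt0.
apply/eqP; rewrite -(eqn_pmul2l q2) cE.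
rewrite [X in _ == X]mulnAC -expnD mulnCA -expnD.
by rewrite mulnC; apply/eqP; congr (_ ^ _ * _)%N; lia.
Qed.

Lemma card_frames (M : {set E}) : subspace M -> hd @: M = L ->
  #|[set m | frame m & [forall j, m j \in M]]| = (#|M :&: E1| ^ k)%N.
Proof.
move=> sM hM.
transitivity #|family (fun j : 'I_k => mem [set v in M | hd v == row j e])|.
  apply: eq_card => m; rewrite !inE; apply/andP/familyP.
    by case=> /forallP h1 /forallP h2 j; rewrite !inE h2 h1.
  by move=> h; split; apply/forallP => j; have := h j; rewrite !inE => /andP[].
rewrite card_family foldrE big_image /= (eq_bigr (fun=> #|M :&: E1|)).
  by rewrite prod_nat_const card_ord.
move=> j _; have : row j e \in hd @: M.
  by rewrite hM; apply/imsetP; exists (delta_mx 0 j); rewrite ?rowE.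
case/imsetP=> v Mv ->; transitivity #|[set u in M | hd u == hd v]|; first exact: eq_card.
by rewrite (card_fiber hd sM Mv); apply: eq_card => u; rewrite !inE.
Qed.

Section FixedFrame.
Variables (m : {ffun 'I_k -> E}) (Phi : {linear E -> K}).
Hypotheses (m_frame : frame m) (parPhi : parametrization m Phi).

Let over (M : {set E}) :=
  [&& xy_submodule x y M, hd @: M == L & [forall j, m j \in M]].
Let pre (U : {set K}) : {set E} := Phi @^-1: U :&: hd @^-1: L.

Lemma Phi_comb c : Phi (comb m c) = 0.
Proof.
rewrite linear_sum big1 // => j _.
by rewrite linearZ /= (par_frame parPhi) scaler0.
Qed.

Lemma comb_in (M : {set E}) c : subspace M -> (forall j, m j \in M) -> comb m c \in M.
Proof. by move=> sM Mm; apply: subspace_sum => // j _; apply: subspaceZ. Qed.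

Lemma head_in (M : {set E}) v : hd @: M = L -> v \in M -> hd v \in L.
Proof. by move=> <-; apply: imset_f. Qed.

Lemma overP M : reflect
  [/\ xy_submodule x y M, subspace M, hd @: M = L & forall j, m j \in M] (over M).
Proof.
apply: (iffP and3P) => [[iM /eqP hM /forallP Mm] | [iM _ hM Mm]]; split=> //.
- by case/xy_submoduleP: iM.
- exact/eqP.
- exact/forallP.
Qed.

Lemma pre_image M : over M -> pre (Phi @: M) = M.
Proof.
case/overP=> iM sM hM Mm; apply/setP=> v; rewrite !inE.
apply/andP/idP => [[/imsetP[u Mu Euv] Lv] | Mv]; last first.
  by rewrite imset_f // (head_in hM).
rewrite -[v](subrK u) subspaceD //.
apply: (par_ker parPhi _ _ iM Mm); last by rewrite linearB /= Euv subrr.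
by rewrite linearB (subspaceB subspaceL Lv (head_in hM Mu)).
Qed.

Lemma image_pre U : Phi @: pre U = U.
Proof.
apply/setP=> kap; apply/imsetP/idP => [[v]|Uk].
  by rewrite !inE => /andP[Uv _] ->.
by have [v Lv Ev] := par_onto parPhi kap; exists v; rewrite // !inE Ev Uk.
Qed.

Lemma pre_over U : xy_submodule xK yK U -> over (pre U).
Proof.
case/xy_submoduleP=> sU Ux Uy; apply/overP.
have sP : subspace (pre U) by rewrite subspaceI ?subspace_preim ?subspaceL.
have L0 : 0 \in L := subspace0 subspaceL.
have preC c : comb m c \in pre U.
  by rewrite !inE Phi_comb subspace0 // head_comb // memL.
split=> //.
- apply/xy_submoduleP; split=> // v; rewrite !inE => /andP[Uv Lv].
    by rewrite (par_x parPhi) // Ux // hdx.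
  by rewrite (par_y parPhi) // Uy // hdy.
- apply/setP=> w; apply/imsetP/idP => [[v]|/imsetP[c _ ->]].
    by rewrite !inE => /andP[_ Lv] ->.
  by exists (comb m c); rewrite ?head_comb.
- move=> j; rewrite !inE (par_frame parPhi) subspace0 //.
  by move/forallP/(_ j)/eqP: m_frame ->; rewrite rowE memL.
Qed.

Lemma image_submodule M : over M -> xy_submodule xK yK (Phi @: M).
Proof.
case/overP=> iM sM hM Mm; case/xy_submoduleP: iM => _ Mx My.
apply/xy_submoduleP; split=> [|_ /imsetP[v Mv ->]|_ /imsetP[v Mv ->]].
- exact: subspace_imset.
- by rewrite -(par_x parPhi) ?(head_in hM) // imset_f ?Mx.
- by rewrite -(par_y parPhi) ?(head_in hM) // imset_f ?My.
Qed.

Let ker : {set E} := [set v in hd @^-1: L | Phi v == 0].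

Lemma ker_sub M : over M -> ker \subset M.
Proof.
case/overP=> iM _ _ Mm; apply/subsetP=> v; rewrite !inE => /andP[Lv /eqP v0].
exact: (par_ker parPhi Lv v0 iM Mm).
Qed.

Lemma subspace_ker : subspace ker.
Proof.
have -> : ker = hd @^-1: L :&: Phi @^-1: [set 0].
  by apply/setP=> v; rewrite !inE.
rewrite subspaceI ?subspace_preim ?subspaceL //.
apply/subspaceP; rewrite !inE; split=> // c u v; rewrite !inE => /eqP-> /eqP->.
by rewrite scaler0 addr0.
Qed.

Lemma card_over M : over M -> #|M| = (#|Phi @: M| * #|ker|)%N.
Proof.
move=> oM; case/overP: (oM) => iM sM hM Mm.
rewrite (card_rank_nullity Phi sM); congr (_ * _)%N; apply: eq_card => v.
rewrite !inE; apply: andb_id2r => v0; apply/idP/idP => [/(head_in hM)//|Lv].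
by apply: (subsetP (ker_sub oM)); rewrite !inE Lv.
Qed.

Lemma card_ker : #|ker| = (q ^ k * #|ker :&: E1|)%N.
Proof.
apply: card_over_L; first exact: subspace_ker.
apply/setP=> w; apply/imsetP/idP => [[v]|/imsetP[c _ ->]].
  by rewrite !inE => /andP[Lv _] ->.
by exists (comb m c); rewrite ?inE ?Phi_comb ?head_comb ?eqxx ?memL.
Qed.

Lemma codim_over M : over M ->
  ldim setT M = (ldim setT (Phi @: M) + (2 - k))%N.
Proof.
move=> oM; case/overP: (oM) => iM sM hM Mm.
apply: ldimE; first exact: subspace_gt0.
have sU := subspace_imset Phi sM.
have cK := card_subspace (subspaceT K) sU (subsetT _).
set d := ldim _ _ in cK *.
have cL : #|hd @^-1: L| = (#|[set: K]| * #|ker|)%N.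
  have sL : subspace (hd @^-1: L) by rewrite subspace_preim ?subspaceL.
  rewrite (card_rank_nullity Phi sL); congr (#|pred_of_set _| * _)%N.
  apply/setP=> kap; rewrite inE; apply/imsetP.
  by have [v Lv <-] := par_onto parPhi kap; exists v; rewrite ?inE.
have cL' : #|hd @^-1: L| = (q ^ k * #|E1|)%N.
  rewrite (card_over_L (M := hd @^-1: L)) ?subspace_preim ?subspaceL //.
    congr (_ * _)%N; apply: eq_card => v; rewrite !inE.
    by apply: andb_idl => /eqP->; apply: subspace0 subspaceL.
  apply/setP=> w; apply/imsetP/idP => [[v]|Lw]; first by rewrite inE => Lv ->.
  by have [v hv] := hd_onto w; exists v; rewrite ?inE hv.
rewrite cardE (card_over oM) expnD -/q.
have E2 : (q ^ 2 = q ^ (2 - k) * q ^ k)%N by rewrite -expnD subnK.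
rewrite E2 -mulnA -cL' cL cK -/q.
by move: #|ker| (q ^ d)%N (q ^ _)%N #|Phi @: M| => *; lia.
Qed.

Lemma image_product M : over M -> Phi @: xy_product x y M = xy_product xK yK (Phi @: M).
Proof.
case/overP=> iM sM hM Mm; apply/setP=> kap; apply/imsetP/xy_productP.
  case=> _ /xy_productP[v1 [v2 [M1 M2 ->]]] ->; exists (Phi v1), (Phi v2).
  by rewrite !imset_f // linearD /= (par_x parPhi) ?(par_y parPhi) ?(head_in hM).
case=> _ [_ [/imsetP[v1 M1 ->] /imsetP[v2 M2 ->] ->]].
exists (x v1 + y v2); first by apply/xy_productP; exists v1, v2.
by rewrite linearD /= (par_x parPhi) ?(par_y parPhi) ?(head_in hM).
Qed.

(** The span of [m] and [xy_product M] is a submodule containing [m], hence contains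
    the kernel of [Phi]. The heads of [xy_product M] vanish and those of [m] are
    independent, so an element of the kernel with zero head has no component
    along [m]. *)
Lemma ker_E1_product M : over M -> ker :&: E1 \subset xy_product x y M.
Proof.
move=> oM; case/overP: (oM) => iM sM hM Mm.
have sR := xy_product_subspace x y sM.
have hR v : v \in xy_product x y M -> hd v = 0.
  by case/xy_productP=> v1 [v2 [_ _ ->]]; rewrite linearD hdx hdy addr0.
pose W := [set comb m p.1 + p.2 | p in setX [set: 'rV[F]_k] (xy_product x y M)].
have memW v : reflect (exists c w, w \in xy_product x y M /\ v = comb m c + w) (v \in W).
  apply: (iffP imsetP) => [[[c w]] | [c [w [Rw ->]]]].
    by rewrite !inE /= => Rw ->; exists c, w.
  by exists (c, w); rewrite ?inE.
have combD a c c' : comb m (a *: c + c') = a *: comb m c + comb m c'.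
  rewrite /comb scaler_sumr -big_split; apply: eq_bigr => j _ /=.
  by rewrite !mxE scalerDl scalerA.
have sW : subspace W.
  apply/subspaceP; split.
    apply/memW; exists 0, 0; rewrite subspace0 // addr0; split=> //.
    by rewrite /comb big1 // => j _; rewrite mxE scale0r.
  move=> a _ _ /memW[c [w [Rw ->]]] /memW[c' [w' [Rw' ->]]].
  apply/memW; exists (a *: c + c'), (a *: w + w').
  by rewrite (subspaceD sR) ?subspaceZ // combD scalerDr addrACA.
have RW w : w \in xy_product x y M -> w \in W.
  move=> Rw; apply/memW; exists 0, w; split=> //.
  by rewrite /comb big1 ?add0r // => j _; rewrite mxE scale0r.
have WM v : v \in W -> v \in M.
  case/memW=> c [w [Rw ->]]; rewrite subspaceD ?comb_in //.
  exact: (subsetP (xy_product_sub iM)).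
have iW : xy_submodule x y W.
  apply/xy_submoduleP; split=> // v /WM Mv; apply: RW.
    exact: xy_product_mull.
  exact: xy_product_mulr.
have Wm j : m j \in W.
  apply/memW; exists (delta_mx 0 j), 0; rewrite subspace0 // addr0; split=> //.
  rewrite /comb (bigD1 j) //= mxE !eqxx scale1r big1 ?addr0 // => i ij.
  by rewrite mxE eqxx (negPf ij) scale0r.
apply/subsetP=> v; rewrite !inE => /andP[/andP[Lv /eqP v0] /eqP hv].
have /memW[c [w [Rw Ev]]] := par_ker parPhi Lv v0 iW Wm.
have c0 : c = 0 by apply: e_free; rewrite -(head_comb _ m_frame) -hv Ev linearD (hR w) ?addr0.
by rewrite Ev c0 /comb big1 ?add0r // => j _; rewrite mxE scale0r.
Qed.

(** The frame accounts for [k] minimal generators of [M], and the remaining ones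
    are those of the image of [M] in [K]. *)
Lemma rank_over M : over M ->
  ldim M (xy_product x y M) = (ldim (Phi @: M) (xy_product xK yK (Phi @: M)) + k)%N.
Proof.
move=> oM; case/overP: (oM) => iM sM hM Mm.
have sR := xy_product_subspace x y sM.
apply: ldimE; first exact: subspace_gt0.
have iU := image_submodule oM; have sU := subspace_imset Phi sM.
have cU := card_subspace sU (xy_product_subspace xK yK sU) (xy_product_sub iU).
set d := ldim _ _ in cU *.
rewrite (card_over oM) card_ker cU (card_rank_nullity Phi sR) (image_product oM) -/q.
have -> : [set v in xy_product x y M | Phi v == 0] = ker :&: E1.
  apply/setP=> v; apply/idP/idP => [|kv].
    rewrite !inE => /andP[/xy_productP[v1 [v2 [_ _ ->]]] ->].
    by rewrite linearD hdx hdy addr0 eqxx (subspace0 subspaceL).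
  rewrite inE (subsetP (ker_E1_product oM) _ kv) /=.
  by case/setIP: kv => + _; rewrite inE => /andP[].
rewrite expnD; move: #|xy_product _ _ _| (q ^ d)%N (q ^ k)%N #|ker :&: E1| => *; lia.
Qed.

Lemma sum_over_frame (R : nzRingType) (w : nat -> nat -> R) :
  \sum_(M | over M) w (ldim setT M) (ldim M (xy_product x y M))
       *+ q ^ (k * (ldim setT M - (2 - k)))
  = quotient_sum xK yK k w.
Proof.
rewrite (reindex_onto pre (fun M => Phi @: M)) /=; last exact: pre_image.
apply: eq_big => [U|U /andP[oU _]].
  rewrite image_pre eqxx andbT; apply/idP/idP => [oU|]; last exact: pre_over.
  by rewrite -(image_pre U) image_submodule.
by rewrite codim_over // rank_over // image_pre addnK.
Qed.

End FixedFrame.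

(** Double counting of the pairs (frame, submodule containing it). The number of
    frames in [M] is [#|E1| ^ k] divided by [#|F| ^ (k * c)], where [c] is the
    codimension of the image of [M] in [K]; this is the origin of the power of
    [#|F|] in [quotient_sum]. *)
Theorem sum_over_heads (R : idomainType) (w : nat -> nat -> R) :
  (forall n, n.+1%:R != 0 :> R) ->
  (forall m, frame m -> exists Phi, parametrization m Phi) ->
  \sum_(M : {set E} | xy_submodule x y M && (hd @: M == L))
     w (ldim setT M) (ldim M (xy_product x y M))
  = quotient_sum xK yK k w.
Proof.
move=> charR parP.
have E1_gt0 : (0 < #|E1|)%N by apply/card_gt0P; exists 0; rewrite inE linear0.
have frames : #|[set m | frame m]| = (#|E1| ^ k)%N.
  have sL : subspace (hd @^-1: L) by rewrite subspace_preim ?subspaceL.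
  have hL : hd @: (hd @^-1: L) = L.
    apply/setP=> v; apply/imsetP/idP => [[u]|Lv]; first by rewrite inE => Lu ->.
    by have [u hu] := hd_onto v; exists u; rewrite ?inE hu.
  have -> : #|E1| = #|hd @^-1: L :&: E1|.
    apply: eq_card => v; rewrite !inE; apply/esym/andb_idl => /eqP->.
    exact: subspace0 subspaceL.
  rewrite -(card_frames sL hL); apply: eq_card => m; rewrite !inE; apply/esym/andb_idr.
  move/forallP=> hm; apply/forallP=> j; rewrite inE (eqP (hm j)) rowE.
  exact: memL.
have nz : (#|E1| ^ k)%N%:R != 0 :> R.
  by rewrite -[(_ ^ _)%N]prednK ?expn_gt0 ?E1_gt0.
apply: (mulIf nz); rewrite !mulr_natr -sumrMnl.
pose G M := w (ldim setT M) (ldim M (xy_product x y M)) *+ q ^ (k * (ldim setT M - (2 - k))).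
transitivity (\sum_(M : {set E} | xy_submodule x y M && (hd @: M == L))
    \sum_(m | frame m && [forall j, m j \in M]) G M).
  apply: eq_bigr => M /andP[/xy_submoduleP[sM _ _] /eqP hM].
  have [_ cM] := codim_ge sM hM.
  rewrite -[RHS]/(\sum_(m | _) _) sumr_const.
  have -> : #|[pred m | frame m & [forall j, m j \in M]]|
      = #|[set m | frame m & [forall j, m j \in M]]|.
    by apply: eq_card => m; rewrite !inE.
  by rewrite card_frames // /G -mulrnA -cM expnMn mulnC -expnM [(k * _)%N]mulnC.
rewrite (exchange_big_dep frame) /=; last by move=> M m _ /andP[].
rewrite (eq_bigr (fun=> quotient_sum xK yK k w)).
  rewrite sumr_const -frames; congr (_ *+ _).
  by apply: eq_card => m; rewrite !inE.
move=> m hm; have [Phi parPhi] := parP m hm.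
rewrite -(sum_over_frame hm parPhi); apply: eq_bigl => M.
by rewrite hm -andbA.
Qed.

End Counting.

(** * Duality for modules with given leading terms *)

Section DualModule.
Variables (F : finFieldType) (r s N k : nat).
Hypotheses (r_gt0 : (0 < r)%N) (s_gt0 : (0 < s)%N).

Definition exponents : predArgType := {p : 'I_N * 'I_N | (p.1.+1 * r + p.2.+1 * s < N)%N}.

(** The dual of [F[X, Y] / J] tensored with [F ^ k], where [J] is spanned by the
    monomials [X^a Y^b] with [a.+1 * r + b.+1 * s >= N]: functions on the
    remaining exponents, which the variables shift. *)
Definition dual_mod := 'M[F]_(#|exponents|, k).

Definition expo (i : 'I_#|exponents|) : nat * nat :=
  let p := val (enum_val i) in (p.1 : nat, p.2 : nat).

Definition read (kap : dual_mod) a b : 'rV[F]_k :=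
  \sum_(i | expo i == (a, b)) row i kap.

Definition build (f : nat -> nat -> 'rV[F]_k) : dual_mod :=
  \matrix_i f (expo i).1 (expo i).2.

Lemma read_build f a b :
  read (build f) a b = if (a.+1 * r + b.+1 * s < N)%N then f a b else 0.
Proof.
rewrite /read; case: ifP => [lt|nlt].
  have aN : (a < N)%N by nia.
  have bN : (b < N)%N by nia.
  pose p : exponents := exist _ (Ordinal aN, Ordinal bN) lt.
  rewrite (big_pred1 (enum_rank p)) => [|i]; first by rewrite rowK /expo enum_rankK.
  apply/eqP/eqP => [[Ea Eb]|->]; last by rewrite /expo enum_rankK.
  apply: enum_val_inj; rewrite enum_rankK; apply: val_inj.
  by apply/eqP; rewrite -pair_eqE /pair_eq -!val_eqE /= Ea Eb !eqxx.
rewrite big1 // => i /eqP[Ea Eb]; case/negP: (negbT nlt).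
by rewrite -Ea -Eb; apply: valP (enum_val i).
Qed.

Lemma read_ext kap kap' : (forall a b, read kap a b = read kap' a b) -> kap = kap'.
Proof.
move=> H; apply/row_matrixP=> i; have := H (expo i).1 (expo i).2.
have exp_inj j : (expo j == ((expo i).1, (expo i).2)) = (j == i).
  apply/eqP/eqP => [[Ea Eb]|->//]; apply: enum_val_inj; apply: val_inj.
  by apply/eqP; rewrite -pair_eqE /pair_eq -!val_eqE /= Ea Eb !eqxx.
by rewrite /read !(big_pred1 i).
Qed.

Lemma read_linear a b : linear (fun kap => read kap a b).
Proof.
move=> c u v; rewrite /read scaler_sumr -big_split.
by apply: eq_bigr => i _; rewrite linearP.
Qed.

Lemma build_linear (V : lmodType F) (f : V -> nat -> nat -> 'rV[F]_k) :
  (forall a b, linear (fun v => f v a b)) -> linear (fun v => build (f v)).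
Proof.
move=> H c u v; apply/row_matrixP => i; rewrite linearP /= !rowK.
exact: (H (expo i).1 (expo i).2 c u v).
Qed.

Definition shiftx (kap : dual_mod) := build (fun a b => read kap a.+1 b).
Definition shifty (kap : dual_mod) := build (fun a b => read kap a b.+1).

Lemma shiftx_linear : linear shiftx.
Proof. by apply: build_linear => a b; apply: read_linear. Qed.
Lemma shifty_linear : linear shifty.
Proof. by apply: build_linear => a b; apply: read_linear. Qed.

HB.instance Definition _ :=
  GRing.isLinear.Build F dual_mod dual_mod *:%R shiftx shiftx_linear.
HB.instance Definition _ :=
  GRing.isLinear.Build F dual_mod dual_mod *:%R shifty shifty_linear.

End DualModule.

Section LeadingTerms.
Variables (F : finFieldType) (E : finLmodType F) (x y : {linear E -> E}).
Variables (r s n : nat) (co : nat -> {linear E -> 'rV[F]_2}) (g h : 'M[F]_2).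
Hypotheses (r_gt0 : (0 < r)%N) (s_gt0 : (0 < s)%N).

Definition vanish i (v : E) := forall j, (j < i)%N -> co j v = 0.

(** The filtration by [vanish] has two-dimensional layers, and [x] and [y] raise
    it by [r] and [s], acting on the layers by [g] and [h]. In the applications
    [x] and [y] are [zeta ^ r * g] and [zeta ^ s * h] up to higher order, on a
    truncation of a free module of rank two over power series in [zeta]. *)
Record leading_terms : Prop := {
  lead_comm : forall v, x (y v) = y (x v);
  lead_sep : forall v, vanish n v -> v = 0;
  lead_onto : forall i w, (i < n)%N ->
    exists2 v, co i v = w & forall j, j != i -> co j v = 0;
  lead_xvanish : forall i v, vanish i v -> vanish (i + r) (x v);
  lead_yvanish : forall i v, vanish i v -> vanish (i + s) (y v);
  lead_xlead : forall i v, vanish i v -> (i + r < n)%N -> co (i + r) (x v) = co i v *m g;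
  lead_ylead : forall i v, vanish i v -> (i + s < n)%N -> co (i + s) (y v) = co i v *m h;
  lead_gh : g * h = h * g }.

Hypothesis lt : leading_terms.

Definition mon a b (v : E) : E := iter a x (iter b y v).

Lemma mon_linear a b : linear (mon a b).
Proof.
move=> c u v; have Hy : iter b y (c *: u + v) = c *: iter b y u + iter b y v.
  by elim: b => //= b ->; rewrite linearP.
by rewrite /mon Hy; elim: a => //= a ->; rewrite linearP.
Qed.

HB.instance Definition _ a b := GRing.isLinear.Build F E E *:%R (mon a b) (mon_linear a b).

Lemma mon_x a b v : mon a b (x v) = mon a.+1 b v.
Proof.
rewrite /mon iterSr; congr (iter a x _).
by elim: b => //= b ->; rewrite (lead_comm lt).
Qed.

Lemma mon_y a b v : mon a b (y v) = mon a b.+1 v.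
Proof. by rewrite /mon iterSr. Qed.

Lemma mon_mon a b a' b' v : mon a b (mon a' b' v) = mon (a + a') (b + b') v.
Proof.
elim: a' a => [|a' IH] a; last by rewrite addnS -addSn -IH -[RHS]mon_x.
rewrite addn0 /mon /=; elim: b' b => [|b' IH] b; first by rewrite addn0.
by rewrite addnS -addSn -IH -iterSr.
Qed.

Lemma vanish0 v : vanish 0 v. Proof. by []. Qed.

Lemma mon_vanish a b i v : vanish i v -> vanish (i + a * r + b * s) (mon a b v).
Proof.
move=> vi; rewrite addnAC; rewrite /mon.
have vy : vanish (i + b * s) (iter b y v).
  elim: b => [|b IH]; first by rewrite addn0.
  by rewrite mulSn [(s + _)%N]addnC addnA; apply: lead_yvanish IH.
elim: a => [|a IH]; first by rewrite addn0.
by rewrite mulSn [(r + _)%N]addnC addnA; apply: lead_xvanish IH.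
Qed.

Arguments mon_vanish a b [i v] _ _ _.

Lemma mon_lead a b i v : vanish i v -> (i + a * r + b * s < n)%N ->
  co (i + a * r + b * s) (mon a b v) = co i v *m (g ^+ a * h ^+ b).
Proof.
move=> vi; rewrite addnAC.
have ly : (i + b * s < n)%N -> co (i + b * s) (mon 0 b v) = co i v *m (h ^+ b).
  elim: b => [|b IH] ltn; first by rewrite addn0 mulmx1.
  have vb := mon_vanish 0 b vi; rewrite addn0 in vb.
  rewrite mulSn [(s + _)%N]addnC addnA in ltn *.
  by rewrite (lead_ylead lt vb) // IH ?exprSr ?mulmxA //; apply: leq_trans ltn; rewrite leq_addr.
have -> : g ^+ a * h ^+ b = h ^+ b * g ^+ a.
  by apply: commrX; apply: commr_sym; apply: commrX; apply: commr_sym; apply: lead_gh lt.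
elim: a => [|a IH] ltn; first by rewrite addn0 in ltn *; rewrite ly ?mulr1.
have va := mon_vanish a b vi; rewrite addnAC in va.
rewrite mulSn [(r + _)%N]addnC addnA in ltn *.
rewrite (lead_xlead lt va) // IH ?exprSr ?mulmxA //.
by apply: leq_trans ltn; rewrite leq_addr.
Qed.

Section Duality.
Variables (N k : nat) (e : 'M[F]_(k, 2)) (phi : 'M[F]_(2, k)).
Hypothesis N_small : (N < n + r + s)%N.

(** What the duality requires of the layers. The rows of
    [e *m (g ^+ a * h ^+ b)] are the leading terms, in degree [a * r + b * s], of
    the submodule generated by a frame; [phi] is the value on the degree
    [D = N - r - s] of the functional that defines the duality. The first two
    fields produce this functional, the third makes the duality onto, and the
    fourth bounds its kernel: a layer vector of degree [i] orthogonal to all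
    monomials of degree [D - i] is a leading term of the submodule. *)
Record layer_duality : Prop := {
  dual_top : forall a b, (a.+1 * r + b.+1 * s = N)%N -> e *m (g ^+ a * h ^+ b) *m phi = 0;
  dual_functional : forall i (tau : nat -> nat -> 'M[F]_k), (i + r + s < N)%N ->
    exists psi, forall a b, (a * r + b * s = i)%N -> e *m (g ^+ a * h ^+ b) *m psi = tau a b;
  dual_vector : forall i (kap : nat -> nat -> 'rV[F]_k), (0 < i)%N ->
    exists w, forall a b, (i + a.+1 * r + b.+1 * s = N)%N ->
      w *m (g ^+ a * h ^+ b) *m phi = kap a b;
  dual_exact : forall i w,
    (forall a b, (i + a.+1 * r + b.+1 * s = N)%N -> w *m (g ^+ a * h ^+ b) *m phi = 0) ->
    exists t : seq ('rV[F]_k * (nat * nat)),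
      (forall p, p \in t -> p.2.1 * r + p.2.2 * s = i)%N /\
      w = \sum_(p <- t) p.1 *m e *m (g ^+ p.2.1 * h ^+ p.2.2) }.

Hypothesis ld : layer_duality.

Variable m : {ffun 'I_k -> E}.
Hypothesis m_frame : frame (co 0) e m.

Lemma head_frame j : co 0 (m j) = row j e.
Proof. by move/forallP/(_ j)/eqP: m_frame. Qed.

(** Built by descending induction on the degree: the correction in degree [i] is
    prescribed on the leading terms of degree [i], where it must cancel the
    contribution of the higher degrees. *)
Lemma functional_exists : exists lam : {linear E -> 'rV[F]_k},
  [/\ forall i v, vanish i v -> (N < i + r + s)%N -> lam v = 0,
      forall i v, vanish i v -> (i + r + s = N)%N -> lam v = co i v *m phi
    & forall a b j, lam (mon a b (m j)) = 0].
Proof.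
suff H t : exists lam : {linear E -> 'rV[F]_k},
  [/\ forall i v, vanish i v -> (N < i + r + s)%N -> lam v = 0,
      forall i v, vanish i v -> (i + r + s = N)%N -> lam v = co i v *m phi
    & forall a b j, (N <= a.+1 * r + b.+1 * s + t)%N -> lam (mon a b (m j)) = 0].
  have [lam [l1 l2 l3]] := H N; exists lam; split=> // a b j.
  by apply: l3; rewrite leq_addl.
elim: t => [|t [lam [l1 l2 l3]]].
  have [lam [l1 l2]] : exists lam : {linear E -> 'rV[F]_k},
      (forall i v, vanish i v -> (N < i + r + s)%N -> lam v = 0) /\
      (forall i v, vanish i v -> (i + r + s = N)%N -> lam v = co i v *m phi).
    have [leN|ltN] := leqP (r + s) N; last first.
      exists \0; split=> // i v _ EN.
      by move: ltN; rewrite -EN -addnA ltnNge leq_addl.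
    pose D := (N - (r + s))%N.
    exists (mulmxr phi \o co D); split=> i v vi EN /=.
      by rewrite vi ?mul0mx //; rewrite /D; lia.
    by congr (co _ v *m _); rewrite /D; lia.
  exists lam; split=> // a b j; rewrite addn0 leq_eqVlt.
  have v0 := mon_vanish a b (vanish0 (m j)); rewrite add0n in v0.
  case/predU1P => [EN | ltN]; last by apply: l1 v0 _; lia.
  rewrite (l2 _ _ v0); last by lia.
  rewrite -[(a * r + b * s)%N]/(0 + a * r + b * s)%N mon_lead ?add0n //; last by lia.
  rewrite head_frame -!row_mul.
  by rewrite (dual_top ld) ?row0.
have [ltN|leN] := ltnP N (r + s + t.+1).
  by exists lam; split=> // a b j _; apply: l3; nia.
pose i := (N - (r + s + t.+1))%N.
have iN : (i + r + s < N)%N by rewrite /i; lia.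
have [psi Hpsi] := dual_functional ld (fun a b => \matrix_j - lam (mon a b (m j))) iN.
exists (lam \+ (mulmxr psi \o co i)); split=> [i' v vi ltN|i' v vi EN|a b j leN'] /=.
- by rewrite (l1 _ _ vi) // vi ?mul0mx ?addr0 // /i; lia.
- by rewrite (l2 _ _ vi) // (vi i) ?mul0mx ?addr0 // /i; lia.
have v0 := mon_vanish a b (vanish0 (m j)); rewrite add0n in v0.
have [ltN|leN2] := leqP N (a.+1 * r + b.+1 * s + t).
  rewrite l3 // v0 ?mul0mx ?addr0 //; rewrite /i; lia.
have Ei : (a * r + b * s = i)%N by rewrite /i; lia.
have -> : co i (mon a b (m j)) = row j e *m (g ^+ a * h ^+ b).
  rewrite -head_frame -mon_lead //; last by lia.
  by rewrite add0n Ei.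
by rewrite -!row_mul Hpsi // rowK addrN.
Qed.

(** The map sends [v] to the function [(a, b) |-> lam (x^a y^b v)]. It is onto by
    corrections of increasing degree, and an element of its kernel can be reduced
    to zero, degree by degree, by elements of the submodule generated by [m]. *)
Lemma duality_parametrization : exists Phi : {linear E -> dual_mod F r s N k},
  parametrization x y (@shiftx F r s N k) (@shifty F r s N k) (co 0) e m Phi.
Proof.
have [lam [l1 l2 l3]] := functional_exists.
pose Phi v := build r s N (fun a b => lam (mon a b v)).
have Phi_lin : linear Phi.
  by apply: build_linear => a b c u v; rewrite !linearP.
pose PhiL : {linear E -> dual_mod F r s N k} := HB.pack Phi
  (GRing.isLinear.Build F E (dual_mod F r s N k) *:%R Phi Phi_lin).
have readPhi v a b : read (Phi v) a b =
    if (a.+1 * r + b.+1 * s < N)%N then lam (mon a b v) else 0.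
  exact: read_build.
have read0 a b : read (0 : dual_mod F r s N k) a b = 0.
  by rewrite /read big1 // => i _; rewrite row0.
(* On the preimage of the span of [e], exponents outside the window give zero. *)
have out v a b : (exists c, co 0 v = c *m e) -> (N <= a.+1 * r + b.+1 * s)%N ->
    lam (mon a b v) = 0.
  case=> c hv; have v0 := mon_vanish a b (vanish0 v); rewrite add0n in v0.
  rewrite leq_eqVlt => /predU1P[EN|ltN]; last by apply: l1 v0 _; lia.
  rewrite (l2 _ _ v0); last by lia.
  rewrite -[(a * r + b * s)%N]/(0 + a * r + b * s)%N mon_lead //; last by lia.
  by rewrite hv -[c *m e *m _]mulmxA -mulmxA (dual_top ld) ?mulmx0.
have Phi_mon0 v a b : Phi v = 0 -> (exists c, co 0 v = c *m e) -> lam (mon a b v) = 0.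
  move=> v0 hv; have := readPhi v a b; rewrite v0 read0.
  by case: ltnP => // le _; apply: out.
exists PhiL; split.
- move=> j; apply: read_ext => // a b; rewrite readPhi read0.
  by rewrite l3 if_same.
- move=> v /imsetP[c _ hv]; apply: read_ext => a b.
  rewrite readPhi /= /shiftx read_build // readPhi mon_x.
  case: ifP => // _; case: ltnP => // le; apply: out => //.
  by exists c.
- move=> v /imsetP[c _ hv]; apply: read_ext => a b.
  rewrite readPhi /= /shifty read_build // readPhi mon_y.
  case: ifP => // _; case: ltnP => // le; apply: out => //.
  by exists c.
- move=> kap.
  have H t : exists v, vanish 1 v /\ forall a b, (a.+1 * r + b.+1 * s < N)%N ->
      (N <= a.+1 * r + b.+1 * s + t)%N -> lam (mon a b v) = read kap a b.
    elim: t => [|t [v [v1 Hv]]].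
      by exists 0; split=> [j _|a b lt1 le1]; [rewrite linear0|lia].
    have [le_n|lt_n] := leqP n t.+1.
      by exists v; split=> // a b lt1 le1; apply: Hv => //; nia.
    have [w Hw] := dual_vector ld (fun a b => read kap a b - lam (mon a b v)) (ltn0Sn t).
    have [u cu u0] := lead_onto lt w lt_n.
    have vu : vanish t.+1 u by move=> j lj; apply: u0; rewrite ltn_eqF.
    exists (v + u); split=> [j lj|a b lt1 le1].
      by rewrite linearD v1 // vu ?addr0 //; case: j lj.
    rewrite !linearD /=; have vm := mon_vanish a b vu.
    have [le2|lt2] := leqP N (a.+1 * r + b.+1 * s + t).
      by rewrite Hv // (l1 _ _ vm) ?addr0 //; lia.
    rewrite (l2 _ _ vm); last by lia.
    rewrite mon_lead //; last by lia.
    rewrite cu Hw; last by lia.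
    by rewrite addrC subrK.
  have [v [v1 Hv]] := H N; exists v.
    rewrite v1 //; apply/imsetP; exists 0 => //; by rewrite mul0mx.
  apply: read_ext => // a b; rewrite readPhi.
  case: ifP => [ab|nab]; first by rewrite Hv // leq_addl.
  rewrite /read big1 // => i /eqP[Ea Eb]; case/negP: (negbT nab).
  by rewrite -Ea -Eb; apply: valP (enum_val i).
- move=> v /imsetP[c _ hv] /= v0 M iM Mm.
  case/xy_submoduleP: (iM) => sM Mx My.
  have Mmon a b u : u \in M -> mon a b u \in M.
    move=> Mu; rewrite /mon; have : iter b y u \in M by elim: b => //= b; apply: My.
    by move: (iter b y u) => {}u {}Mu; elim: a => //= a; apply: Mx.
  have lamPhi0 u : (forall a b, lam (mon a b u) = 0) -> Phi u = 0.
    by move=> H; apply: read_ext => // a b; rewrite readPhi H if_same read0.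
  have Mcomb c' : comb m c' \in M by apply: subspace_sum => // j _; apply: subspaceZ.
  have lam_comb a b c' : lam (mon a b (comb m c')) = 0.
    rewrite !linear_sum big1 // => j _; by rewrite !linearZ /= l3 scaler0.
  (* Reduction of the leading term, by descending induction on the degree [i]. *)
  have van_split t i u : (i + t = n)%N -> (0 < i)%N -> vanish i u -> Phi u = 0 -> u \in M.
    elim: t i u => [|t IH] i u En i0 vi u0.
      by rewrite addn0 in En; rewrite (lead_sep lt (v := u)) ?subspace0 // -En.
    have hu : exists c, co 0 u = c *m e by exists 0; rewrite vi // mul0mx.
    have [T [HT ET]] : exists t : seq ('rV[F]_k * (nat * nat)),
      (forall p, p \in t -> p.2.1 * r + p.2.2 * s = i)%N /\
      co i u = \sum_(p <- t) p.1 *m e *m (g ^+ p.2.1 * h ^+ p.2.2).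
      apply: (dual_exact ld) => a b Eab; rewrite -mon_lead //; last by lia.
      by rewrite -(l2 _ _ (mon_vanish a b vi)) ?Phi_mon0 //; lia.
    pose z := \sum_(p <- T) mon p.2.1 p.2.2 (comb m p.1).
    have Mz : z \in M by apply: subspace_sum => // p _; apply: Mmon.
    rewrite -[u](subrK z) subspaceD //; apply: (IH i.+1) => //; first by lia.
      have zv p : p \in T -> vanish i (mon p.2.1 p.2.2 (comb m p.1)).
        move=> Tp; rewrite -(HT p Tp).
        by have := mon_vanish p.2.1 p.2.2 (vanish0 (comb m p.1)); rewrite add0n.
      move=> j; rewrite ltnS leq_eqVlt => /predU1P[->|lj].
        rewrite linearB /= ET /z linear_sum -sumrB big1_seq // => p /andP[_ Tp].
        rewrite -(head_comb _ m_frame) -mon_lead //; last by rewrite add0n HT //; lia.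
        by rewrite add0n HT // subrr.
      rewrite linearB /= vi // sub0r linear_sum big1_seq ?oppr0 // => p /andP[_ Tp].
      exact: zv.
    apply: lamPhi0 => a b; rewrite !linearB /= Phi_mon0 // sub0r !linear_sum /=.
    by rewrite big1 // => p _; rewrite mon_mon lam_comb oppr0.
  rewrite -[v](subrK (comb m c)) subspaceD //.
  case: (posnP n) => [n0|n_gt0].
    by rewrite (lead_sep lt (v := v - _)) ?subspace0 // => j; rewrite n0.
  apply: (van_split n.-1 1%N); rewrite ?add1n ?prednK //.
    by case=> // _; rewrite linearB /= (head_comb _ m_frame) hv subrr.
  apply: lamPhi0 => a b; rewrite !linearB /= lam_comb subr0 Phi_mon0 //.
  by exists c.
Qed.

End Duality.
End LeadingTerms.

(** * The dualities on the layers *)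

Section LayerDualities.
Variables (F : finFieldType) (r s : nat) (g h : 'M[F]_2).
Hypotheses (r_gt0 : (0 < r)%N) (s_gt0 : (0 < s)%N) (co_rs : coprime r s).
Hypotheses (gU : g \in unitmx) (hU : h \in unitmx) (gh : g * h = h * g).

Let P a b : 'M[F]_2 := g ^+ a * h ^+ b.

Lemma monomial_unit a b : P a b \in unitmx.
Proof. by rewrite unitmx_mul !unitrX. Qed.

Lemma monomialD a b a' b' : P (a + a') (b + b') = P a b *m P a' b'.
Proof.
rewrite /P !exprD -mulmxE -!mulmxA; congr (_ *m _); rewrite !mulmxA.
congr (_ *m _); apply: commrX; apply: commr_sym; apply: commrX.
exact: commr_sym.
Qed.

Lemma monomialC a b a' b' : P a b *m P a' b' = P a' b' *m P a b.
Proof. by rewrite -!monomialD addnC [(b + _)%N]addnC. Qed.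

Lemma mulmx_monomial_eq0 (w : 'rV[F]_2) a b : w *m P a b = 0 -> w = 0.
Proof.
by move=> w0; rewrite -(mulmxK (monomial_unit a b) w) w0 mul0mx.
Qed.

(** Below [r * s] a degree is represented by at most one monomial, and [i] is
    represented exactly when [r * s - r - s - i] is not. So the layer of degree
    [i] is either filled by the two leading terms of one monomial or paired
    perfectly with the top degree by one monomial. *)
Lemma full_layer_duality : layer_duality r s g h (r * s) (1%:M : 'M[F]_2) 1%:M.
Proof.
split.
- move=> a b E; exfalso.
  exact: (gap_not_rep r_gt0 s_gt0 co_rs (i := 0) E (a' := 0) (b' := 0)).
- move=> i tau lt_i.
  case: (gap_or_rep r_gt0 s_gt0 co_rs i) => [[a [b Eab]]|[a [b Eab]]]; last first.
    by exists 0 => a' b' Ei; case: (gap_not_rep r_gt0 s_gt0 co_rs Eab Ei).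
  exists (invmx (P a b) *m tau a b) => a' b' Eab'; rewrite mul1mx -/(P a' b').
  have [] := rep_unique r_gt0 s_gt0 co_rs (etrans Eab' (esym Eab)); first by lia.
  by move=> -> ->; rewrite mulKVmx ?monomial_unit.
- move=> i kap i_gt0.
  have [lt_i|le_i] := ltnP (r * s) (i + r + s); first by exists 0 => a b Eab; lia.
  pose l := (r * s - (i + r + s))%N.
  case: (gap_or_rep r_gt0 s_gt0 co_rs l) => [[a [b Eab]]|[a [b Eab]]]; last first.
    exists 0 => a' b' Ei; case: (gap_not_rep r_gt0 s_gt0 co_rs Eab (a' := a') (b' := b')).
    by rewrite /l; lia.
  exists (kap a b *m invmx (P a b)) => a' b' Eab'; rewrite mulmx1 -/(P a' b').
  have E : (a' * r + b' * s = a * r + b * s)%N by rewrite Eab /l; lia.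
  have [] := rep_unique r_gt0 s_gt0 co_rs E; first by rewrite E Eab /l; nia.
  by move=> -> ->; rewrite mulmxKV ?monomial_unit.
- move=> i w Hw; case: (gap_or_rep r_gt0 s_gt0 co_rs i) => [[a [b Eab]]|[a [b Eab]]].
    exists [:: (w *m invmx (P a b), (a, b))]; split=> [p|].
      by rewrite inE => /eqP->.
    by rewrite big_seq1 /= mulmx1 -/(P a b) mulmxKV ?monomial_unit.
  exists [::]; split=> //; rewrite big_nil; apply: (@mulmx_monomial_eq0 _ a b).
  by rewrite -(Hw a b Eab) mulmx1.
Qed.

Section Line.
Variable e : 'rV[F]_2.

(** Equivalently, [e] is not an eigenvector of [g ^+ s * h ^- r], the ratio of the
    two monomials of degree [r * s]. *)
Hypothesis eU : (col_mx (e *m h ^+ r) (e *m g ^+ s) : 'M_(1 + 1, 2)) \in unitmx.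

Let W : 'M[F]_(1 + 1, 2) := col_mx (e *m h ^+ r) (e *m g ^+ s).

Lemma line_neq0 : e != 0.
Proof.
apply: contraTneq eU => ->; rewrite !mul0mx col_mx0.
by rewrite unitmxE det0 ?unitr0.
Qed.

Lemma monomialDg a b : P (a + s) b = g ^+ s *m P a b.
Proof. by rewrite addnC -[b]add0n monomialD /P mulr1. Qed.

Lemma monomialDh a b : P a (b + r) = h ^+ r *m P a b.
Proof. by rewrite addnC -[a in LHS]add0n monomialD /P mul1r. Qed.

Lemma monomialDgr a b : P (a + s) b = P a b *m g ^+ s.
Proof. by rewrite -[b in LHS]addn0 monomialD /P mulr1. Qed.

Lemma monomialDhr a b : P a (b + r) = P a b *m h ^+ r.
Proof. by rewrite -[a in LHS]addn0 monomialD /P mul1r. Qed.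

(* The leading term in the top degree [2 * r * s - r - s], whose only monomial is
   [(s - 1, r - 1)], and a vector spanning its orthogonal. *)
Let e' := e *m P s.-1 r.-1.
Let phi : 'cV[F]_2 := \col_i (if i == 0 then e' 0 1 else - e' 0 0).

Lemma ord2E (i : 'I_2) : i = 0 \/ i = 1.
Proof. by case: i => [[|[|//]]] lt; [left|right]; apply: val_inj. Qed.

Lemma mul_phi (w : 'rV[F]_2) : (w *m phi) = (w 0 0 * e' 0 1 - w 0 1 * e' 0 0)%:M.
Proof.
apply/matrixP=> i j; rewrite !ord1 !mxE eqxx mulr1n big_ord_recl big_ord1.
by rewrite !mxE /= mulrN; congr (_ - w 0 _ * _); apply: val_inj.
Qed.

Lemma e'_neq0 : e' != 0.
Proof. by apply: contraNneq line_neq0 => /mulmx_monomial_eq0->. Qed.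

Lemma e'_phi : e' *m phi = 0.
Proof.
rewrite mul_phi mulrC subrr; apply/matrixP=> i j; by rewrite !mxE mul0rn.
Qed.

Lemma phi_orthogonal w : w *m phi = 0 -> exists c, w = c *: e'.
Proof.
rewrite mul_phi => /(congr1 mxtrace); rewrite mxtrace_scalar mxtrace0 mulr1n => /eqP.
rewrite subr_eq0 => /eqP E.
have [e0|e0] := eqVneq (e' 0 0) 0.
  have e1 : e' 0 1 != 0.
    apply: contraNneq e'_neq0 => e1; apply/eqP/rowP=> i; rewrite [RHS]mxE.
    by case: (ord2E i) => ->.
  exists (w 0 1 / e' 0 1); apply/rowP=> i; rewrite mxE.
  have w0 : w 0 0 = 0.
    by move/eqP: E; rewrite e0 mulr0 mulf_eq0 (negPf e1) orbF => /eqP.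
  by case: (ord2E i) => ->; rewrite ?e0 ?w0 ?mulr0 // divfK.
exists (w 0 0 / e' 0 0); apply/rowP=> i; rewrite mxE.
case: (ord2E i) => ->; first by rewrite divfK.
by rewrite mulrAC E mulfK.
Qed.

Let W' : 'M[F]_(2, 1 + 1) := row_mx (h ^+ r *m phi) (g ^+ s *m phi).

(** With [T = g ^+ s * h ^- r], the product of the rows [e'], [e' T] by the columns
    [phi], [T phi] has determinant [- (e' T phi) ^ 2], and [e' T phi] is nonzero
    because [e'] kills the nonzero [phi] while [e'] and [e' T] span. *)
Lemma dual_unit : W' \in unitmx.
Proof.
pose hr := h ^+ r; pose gs := g ^+ s.
have hrU : hr \in unitmx by rewrite unitrX.
pose T := gs *m invmx hr.
have comm_e' : e' *m hr = e *m hr *m P s.-1 r.-1 /\ e' *m gs = e *m gs *m P s.-1 r.-1.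
  have hrE : hr = P 0 r by rewrite /P mul1r.
  have gsE0 : gs = P s 0 by rewrite /P mulr1.
  rewrite /e' hrE gsE0.
  by split; rewrite -[LHS]mulmxA -[RHS]mulmxA; congr (e *m _); apply: monomialC.
have gsE : gs = T *m hr by rewrite mulmxKV.
have ghr : gs *m hr = hr *m gs by have := monomialC s 0 0 r; rewrite /P !mul1r !mulr1.
have gsE' : gs = hr *m T.
  by rewrite /T mulmxA -ghr mulmxK.
have W2E : col_mx e' (e' *m T) *m hr = W *m P s.-1 r.-1.
  by rewrite !mul_col_mx -(mulmxA e') -gsE; case: comm_e' => -> ->.
have W2U : col_mx e' (e' *m T) \in unitmx.
  have : col_mx e' (e' *m T) *m hr \in unitmx by rewrite W2E unitmx_mul eU monomial_unit.
  by rewrite unitmx_mul => /andP[].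
have W'E : W' = hr *m row_mx phi (T *m phi).
  by rewrite mul_mx_row /W' mulmxA -gsE'.
rewrite W'E unitmx_mul hrU /=.
suff : col_mx e' (e' *m T) *m row_mx phi (T *m phi) \in unitmx.
  by rewrite unitmx_mul => /andP[].
rewrite mul_col_row e'_phi.
pose d := e' *m (T *m phi).
have dE : e' *m T *m phi = d by rewrite -mulmxA.
have d0 : d != 0.
  apply/eqP=> d0.
  have phi0 : phi = 0.
    by rewrite -(mulKmx W2U phi) mul_col_mx e'_phi dE d0 col_mx0 mulmx0.
  move/eqP: e'_neq0; apply; apply/rowP=> i; rewrite [RHS]mxE.
  have e1 : e' 0 1 = 0.
    by have := congr1 (fun A : 'cV_2 => A 0 0) phi0; rewrite [LHS]mxE [RHS]mxE.
  have /eqP : - e' 0 0 = 0.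
    by have := congr1 (fun A : 'cV_2 => A 1 0) phi0; rewrite [LHS]mxE [RHS]mxE.
  rewrite oppr_eq0 => /eqP e0.
  by case: (ord2E i) => ->.
rewrite dE -/d unitmxE.
set t := e' *m T *m (T *m phi).
have -> : block_mx 0 d d t = block_mx 0 1%:M 1%:M 0 *m block_mx d t 0 d.
  by rewrite mulmx_block !mul0mx !mul1mx !add0r !addr0.
have swapU : (block_mx 0 1%:M 1%:M 0 : 'M[F]_(1 + 1)) \in unitmx.
  suff /mulmx1_unit[] : (block_mx 0 1%:M 1%:M 0 : 'M[F]_(1 + 1)) *m
    block_mx 0 1%:M 1%:M 0 = 1%:M by [].
  by rewrite mulmx_block !mul0mx !mul1mx !addr0 !add0r -scalar_mx_block.
have detd : \det d != 0.
  rewrite det_mx11; apply: contraNneq d0 => d00.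
  by apply/eqP/matrixP => i j; rewrite !ord1 d00 [RHS]mxE.
by rewrite -unitmxE unitmx_mul swapU /= unitmxE det_ublock unitfE mulf_neq0.
Qed.

(** Below [2 * r * s] a degree is represented by at most two monomials, which
    differ by [(s, - r)]. The numbers of monomials of degrees [i] and
    [2 * r * s - r - s - i] add up to two, the dimension of a layer: leading
    terms are independent by [eU], functionals by [dual_unit], and when each side
    has one monomial the top leading term [e'] is orthogonal to [phi]. *)
Lemma line_layer_duality : layer_duality r s g h (2 * r * s) e phi.
Proof.
split.
- move=> a b E; have := rep_step r_gt0 s_gt0 co_rs (a := a.+1) (b := b.+1) (a0 := 0) (b0 := 2 * r).
  rewrite E mul0n add0n => -[//|//|k [Ea Eb]].
  case: k Ea Eb => [|[|k]] Ea Eb; [lia | | nia].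
  have -> : a = s.-1 by lia.
  have -> : b = r.-1 by lia.
  exact: e'_phi.
- move=> i tau lt_i.
  case: (gap_or_rep r_gt0 s_gt0 co_rs i) => [[a [b Eab]]|[a [b Eab]]]; last first.
    by exists 0 => a' b' Ei; case: (gap_not_rep r_gt0 s_gt0 co_rs Eab Ei).
  have [a0 [b0 [a0s E0 _]]] := rep_canonical r_gt0 s_gt0 co_rs a b.
  have two a' b' : (a' * r + b' * s = i)%N ->
      (a' = a0 /\ b' = b0) \/ (a' = a0 + s /\ b0 = b' + r)%N.
    by move=> Ei; apply: (rep_at_most_two r_gt0 s_gt0 co_rs a0s); lia.
  have [le_r|lt_r] := leqP r b0.
    pose Q := P a0 (b0 - r).
    pose psi := invmx (W *m Q) *m col_mx (tau a0 b0) (tau (a0 + s) (b0 - r))%N.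
    have : W *m Q *m psi = col_mx (tau a0 b0) (tau (a0 + s) (b0 - r))%N.
      by rewrite mulKVmx // unitmx_mul eU monomial_unit.
    rewrite !mul_col_mx => /eq_col_mx[E1 E2]; exists psi => a' b'.
    rewrite -/(P a' b') => /two[] [-> Eb].
      by rewrite Eb -E1 -[in LHS](subnK le_r) monomialDh mulmxA.
    have -> : b' = (b0 - r)%N by lia.
    by rewrite -E2 monomialDg mulmxA.
  exists (invmx (P a0 b0) *m (h ^+ r *m (invmx W *m col_mx (tau a0 b0) 0))) => a' b'.
  rewrite -/(P a' b') => /two[] [-> Eb]; last by lia.
  rewrite Eb mulmxA mulmxK ?monomial_unit // mulmxA.
  have : W *m (invmx W *m col_mx (tau a0 b0) 0) = col_mx (tau a0 b0) 0 by rewrite mulKVmx.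
  by rewrite mul_col_mx => /eq_col_mx[].
- move=> i kap i_gt0.
  have [lt_i|le_i] := ltnP (2 * r * s) (i + r + s); first by exists 0 => a b Eab; lia.
  pose l := (2 * r * s - (i + r + s))%N.
  case: (gap_or_rep r_gt0 s_gt0 co_rs l) => [[a [b Eab]]|[a [b Eab]]]; last first.
    exists 0 => a' b' Ei; case: (gap_not_rep r_gt0 s_gt0 co_rs Eab (a' := a') (b' := b')).
    by rewrite /l; lia.
  have [a0 [b0 [a0s E0 _]]] := rep_canonical r_gt0 s_gt0 co_rs a b.
  have two a' b' : (i + a'.+1 * r + b'.+1 * s = 2 * r * s)%N ->
      (a' = a0 /\ b' = b0) \/ (a' = a0 + s /\ b0 = b' + r)%N.
    by move=> Ei; apply: (rep_at_most_two r_gt0 s_gt0 co_rs a0s); rewrite /l in Eab; lia.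
  have [le_r|lt_r] := leqP r b0.
    pose Q := P a0 (b0 - r).
    pose w := row_mx (kap a0 b0) (kap (a0 + s) (b0 - r))%N *m invmx (Q *m W').
    have : w *m (Q *m W') = row_mx (kap a0 b0) (kap (a0 + s) (b0 - r))%N.
      by rewrite mulmxKV // unitmx_mul dual_unit monomial_unit.
    rewrite !mul_mx_row => /eq_row_mx[E1 E2]; exists w => a' b'.
    rewrite -/(P a' b') => /two[] [-> Eb].
      by rewrite Eb -E1 -[in LHS](subnK le_r) monomialDhr !mulmxA.
    have -> : b' = (b0 - r)%N by lia.
    by rewrite -E2 monomialDgr !mulmxA.
  exists (row_mx (kap a0 b0) 0 *m invmx W' *m h ^+ r *m invmx (P a0 b0)) => a' b'.
  rewrite -/(P a' b') => /two[] [-> Eb]; last by lia.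
  rewrite Eb mulmxKV ?monomial_unit // -mulmxA.
  have : row_mx (kap a0 b0) 0 *m invmx W' *m W' = row_mx (kap a0 b0) 0.
    by rewrite mulmxKV ?dual_unit.
  by rewrite mul_mx_row => /eq_row_mx[].
- move=> i w Hw; case: (gap_or_rep r_gt0 s_gt0 co_rs i) => [[a [b Eab]]|[a [b Eab]]]; last first.
    exists [::]; split=> //; rewrite big_nil; apply: (@mulmx_monomial_eq0 _ a b).
    suff : w *m P a b *m W' = 0 by move=> H; rewrite -(mulmxK dual_unit (w *m P a b)) H mul0mx.
    have Hh : w *m P a b *m (h ^+ r *m phi) = 0.
      by rewrite mulmxA -[w *m _ *m _]mulmxA -monomialDhr; apply: Hw; lia.
    have Hg : w *m P a b *m (g ^+ s *m phi) = 0.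
      by rewrite mulmxA -[w *m _ *m _]mulmxA -monomialDgr; apply: Hw; lia.
    by rewrite mul_mx_row Hh Hg row_mx0.
  have [a0 [b0 [a0s E0 _]]] := rep_canonical r_gt0 s_gt0 co_rs a b.
  have [le_r|lt_r] := leqP r b0.
    pose Q := P a0 (b0 - r).
    pose c : 'rV[F]_(1 + 1) := w *m invmx (W *m Q).
    exists [:: (lsubmx c, (a0, b0)); (rsubmx c, (a0 + s, b0 - r))%N]; split=> [p|].
      by rewrite !inE => /pred2P[] -> /=; nia.
    rewrite big_cons big_seq1 /= -/(P a0 b0) -/(P (a0 + s) (b0 - r)).
    have Ew : w = c *m (W *m Q) by rewrite mulmxKV // unitmx_mul eU monomial_unit.
    rewrite [LHS]Ew mul_col_mx -{1}[c]hsubmxK mul_row_col.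
    have -> : P a0 b0 = h ^+ r *m Q by rewrite -monomialDh subnK.
    by rewrite monomialDg -/Q !mulmxA.
  have Hw' : w *m P (s.-1 - a0) (r.-1 - b0) *m phi = 0 by apply: Hw; nia.
  have [c Ec] := phi_orthogonal Hw'.
  exists [:: (c%:M, (a0, b0))]; split=> [p|]; first by rewrite inE => /eqP->; rewrite /= E0.
  rewrite big_seq1 /= mul_scalar_mx -/(P a0 b0).
  rewrite -(mulmxK (monomial_unit (s.-1 - a0) (r.-1 - b0)) w) Ec /e'.
  have -> : P s.-1 r.-1 = P a0 b0 *m P (s.-1 - a0) (r.-1 - b0).
    by rewrite -monomialD !subnKC //; lia.
  by rewrite scalemxAl mulmxA mulmxK ?monomial_unit // scalemxAl.
Qed.

End Line.
End LayerDualities.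

Section HeadSums.
Variables (F : finFieldType) (E : finLmodType F) (x y : {linear E -> E}).
Variables (r s n : nat) (co : nat -> {linear E -> 'rV[F]_2}) (g h : 'M[F]_2).
Hypotheses (r_gt0 : (0 < r)%N) (s_gt0 : (0 < s)%N) (co_rs : coprime r s).
Hypotheses (gU : g \in unitmx) (hU : h \in unitmx) (n_ge : (2 * r * s <= n)%N).
Hypothesis lt : leading_terms x y r s n co g h.
Variables (R : idomainType) (w : nat -> nat -> R).
Hypothesis charR : forall i, i.+1%:R != 0 :> R.

Lemma head_onto v : exists u, co 0 u = v.
Proof.
have n_gt0 : (0 < n)%N by apply: leq_trans n_ge; rewrite !muln_gt0 r_gt0 s_gt0.
by have [u hu _] := lead_onto lt v n_gt0; exists u.
Qed.

Lemma head_x v : co 0 (x v) = 0.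
Proof. by apply: (lead_xvanish lt (i := 0)). Qed.

Lemma head_y v : co 0 (y v) = 0.
Proof. by apply: (lead_yvanish lt (i := 0)). Qed.

Theorem sum_full_head :
  \sum_(M : {set E} | xy_submodule x y M && (co 0 @: M == setT))
     w (ldim setT M) (ldim M (xy_product x y M))
  = quotient_sum (@shiftx F r s (r * s) 2) (@shifty F r s (r * s) 2) 2 w.
Proof.
have LT : [set: 'rV[F]_2] = [set c *m 1%:M | c : 'rV[F]_2].
  by apply/esym/setP=> v; rewrite inE; apply/imsetP; exists v; rewrite ?mulmx1.
rewrite LT; apply: sum_over_heads => //.
- exact: head_onto.
- exact: head_x.
- exact: head_y.
- by move=> c; rewrite mulmx1.
- move=> m hm; apply: (duality_parametrization r_gt0 s_gt0 lt _ _ hm (phi := 1%:M)).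
    by nia.
  by apply: full_layer_duality => //; apply: lead_gh lt.
Qed.

Theorem sum_line_head (e : 'rV[F]_2) :
  (col_mx (e *m h ^+ r) (e *m g ^+ s) : 'M_(1 + 1, 2)) \in unitmx ->
  \sum_(M : {set E} | xy_submodule x y M && (co 0 @: M == [set c *m e | c : 'rV[F]_1]))
     w (ldim setT M) (ldim M (xy_product x y M))
  = quotient_sum (@shiftx F r s (2 * r * s) 1) (@shifty F r s (2 * r * s) 1) 1 w.
Proof.
move=> eU; apply: sum_over_heads => //.
- exact: head_onto.
- exact: head_x.
- exact: head_y.
- move=> c; rewrite [c]mx11_scalar mul_scalar_mx => /eqP.
  by rewrite scaler_eq0 (negPf (line_neq0 eU)) orbF => /eqP->; rewrite raddf0.
- move=> m hm; have gh := lead_gh lt.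
  have ld := line_layer_duality r_gt0 s_gt0 co_rs gU hU gh eU.
  by apply: (duality_parametrization r_gt0 s_gt0 lt _ ld hm); nia.
Qed.

End HeadSums.

From mathcomp Require Import boolp classical_sets functions cardinality fsbigop.

(** * Elements of a power series subring *)

Definition weight (F : finFieldType) (c d rho : nat) : {poly {poly int}} :=
  varT ^+ d * \prod_(c <= j < rho) (1 + varA * qpol F ^+ j).

Section PowerSeriesSubring.
Variables (F : finFieldType) (O : comAlgType F) (z X Y : O).

Lemma power_series_approx f k : power_series_ring z X Y f ->
  exists (c : nat -> nat -> F) N g,
    f = \sum_(i < N) \sum_(j < N) c i j *: (X ^+ i * Y ^+ j) + z ^+ k * g.
Proof.
case=> c /(_ k)[N /(_ N (leqnn N))[g Eg]]; exists c, N, g.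
by rewrite -Eg addrC subrK.
Qed.

Lemma monomial_in (c : F) a b : power_series_ring z X Y (c *: (X ^+ a * Y ^+ b)).
Proof.
exists (fun i j => if (i == a) && (j == b) then c else 0) => k.
exists (maxn a b).+1 => N; rewrite gtn_max => /andP[aN bN]; exists 0.
rewrite mulr0 (bigD1 (Ordinal aN)) //= (bigD1 (Ordinal bN)) //= !eqxx /=.
rewrite big1 => [|j jb]; last first.
  by rewrite -val_eqE /= in jb; rewrite (negPf jb) scale0r.
rewrite big1 => [|i ia]; first by rewrite !addr0 subrr.
rewrite -val_eqE /= in ia; rewrite big1 // => j _.
by rewrite (negPf ia) scale0r.
Qed.

(** The homogeneous corrections of distinct degrees involve distinct monomials, so
    they assemble into one double series. *)
Lemma successive_approximation (r s C ex : nat) (Fil : nat -> O -> Prop) :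
  (0 < r)%N -> (0 < s)%N -> (0 < ex)%N ->
  (forall i f f', Fil i f -> Fil i f' -> Fil i (f - f')) ->
  (forall i c f, Fil i f -> Fil i (c *: f)) ->
  (forall i f, Fil i.+1 f -> Fil i f) ->
  (forall i f, Fil i f -> exists g, f = z ^+ (ex * i) * g) ->
  (forall a b, Fil (a * r + b * s)%N (X ^+ a * Y ^+ b)) ->
  (forall i f, (C <= i)%N -> Fil i f -> exists c : nat -> nat -> F,
     Fil i.+1 (f - \sum_(a < i.+1) \sum_(b < i.+1 | (a * r + b * s == i)%N)
                    c a b *: (X ^+ a * Y ^+ b))) ->
  forall f, Fil C f -> power_series_ring z X Y f.
Proof.
move=> r_gt0 s_gt0 ex_gt0 FilB FilZ FilS Filz FilM step f FilCf.
pose hom (c : nat -> nat -> F) i := \sum_(a < i.+1) \sum_(b < i.+1 | (a * r + b * s == i)%N)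
                    c a b *: (X ^+ a * Y ^+ b).
have /choice[cc Hcc] (p : nat * O) : exists c : nat -> nat -> F,
    (C <= p.1)%N -> Fil p.1 p.2 -> Fil p.1.+1 (p.2 - hom c p.1).
  case: (pselect ((C <= p.1)%N /\ Fil p.1 p.2)) => [[h1 h2]|nh].
    by have [c Hc] := step _ _ h1 h2; exists c.
  by exists (fun _ _ => 0) => h1 h2; case: nh.
(* What is left of [f] after the corrections of degrees [C, ..., C + n - 1]. *)
pose fix rest n := if n is n'.+1 then rest n' - hom (cc (C + n', rest n')%N) (C + n') else f.
have Fil_rest n : Fil (C + n)%N (rest n).
  elim: n => [|n IH]; first by rewrite addn0.
  by rewrite addnS; apply: (Hcc (C + n, rest n)%N) => //; apply: leq_addr.
have FilW i j g : (i <= j)%N -> Fil j g -> Fil i g.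
  by move=> /subnKC <-; elim: (j - i)%N => [|d IH]; rewrite ?addn0 // addnS => /FilS.
pose cd i := if (C <= i)%N then cc (i, rest (i - C))%N else fun _ _ => 0.
pose c a b := cd (a * r + b * s)%N a b.
have restE n : rest n = f - \sum_(i < C + n) hom c i.
  have hom0 i : (i < C)%N -> hom c i = 0.
    move=> lt; rewrite /hom big1 // => a _; rewrite big1 // => b /eqP Eab.
    by rewrite /c /cd Eab leqNgt lt scale0r.
  elim: n => [|n IH].
    by rewrite addn0 big1 ?subr0 // => i _; apply: hom0.
  rewrite addnS big_ord_recr /= opprD addrA -IH; congr (_ - _).
  apply: eq_bigr => a _; apply: eq_bigr => b /eqP Eab.
  by rewrite /c /cd Eab leq_addr addKn.
exists c => k; exists (C + k)%N => N leN.
suff H : Fil k (f - \sum_(i < N) \sum_(j < N) c i j *: (X ^+ i * Y ^+ j)).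
  have [g ->] := Filz _ _ H.
  exists (z ^+ (ex * k - k) * g); rewrite mulrA -exprD subnKC //.
  by rewrite leq_pmull.
have Fil0 i : Fil i 0.
  rewrite -(subrr (X ^+ i * Y ^+ 0)); apply: FilB; apply: (FilW _ (i * r + 0 * s)%N) => //;
  by rewrite mul0n addn0 leq_pmulr.
have FilD i g g' : Fil i g -> Fil i g' -> Fil i (g + g').
  by move=> Hg Hg'; rewrite -[g']opprK; apply: (FilB) => //; rewrite -sub0r; apply: FilB.
pose small i j := (i * r + j * s < C + k)%N.
have -> : \sum_(i < N) \sum_(j < N) c i j *: (X ^+ i * Y ^+ j)
  = \sum_(i < N) \sum_(j < N) (if small i j then c i j *: (X ^+ i * Y ^+ j) else 0)
  + \sum_(i < N) \sum_(j < N) (if small i j then 0 else c i j *: (X ^+ i * Y ^+ j)).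
  rewrite -big_split; apply: eq_bigr => i _; rewrite -big_split; apply: eq_bigr => j _ /=.
  by case: ifP; rewrite ?addr0 ?add0r.
rewrite opprD addrA; apply: FilB; last first.
  have FilSum (I : finType) l (u : I -> O) : (forall i, Fil l (u i)) -> Fil l (\sum_i u i).
    by move=> Hu; elim/big_ind: _ => [//|u1 u2|i _]; [exact: FilD | exact: Hu].
  apply: (FilSum) => i; apply: (FilSum) => j; rewrite /small; case: ltnP => // le.
  by apply: FilZ; apply: FilW (FilM i j); lia.
suff -> : \sum_(i < N) \sum_(j < N) (if small i j then c i j *: (X ^+ i * Y ^+ j) else 0)
    = \sum_(i < C + k) hom c i.
  by rewrite -restE; apply: FilW (Fil_rest k); rewrite leq_addl.
transitivity (\sum_(i < N) \sum_(j < N) \sum_(l < C + k | (i * r + j * s == l)%N)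
    c i j *: (X ^+ i * Y ^+ j)).
  apply: eq_bigr => i _; apply: eq_bigr => j _; rewrite /small; case: ltnP => lt.
    rewrite (big_pred1 (Ordinal lt)) // => l; by rewrite /= eq_sym -val_eqE.
  by rewrite big1 // => l /eqP El; move: (ltn_ord l); rewrite -El ltnNge lt.
under eq_bigr do rewrite (exchange_big_dep predT) //=.
rewrite (exchange_big_dep predT) //=; apply: eq_bigr => l _.
pose inner i := \sum_(j < l.+1 | (i * r + j * s == l)%N) c i j *: (X ^+ i * Y ^+ j).
rewrite /hom (big_ord_widen N inner); last first.
  by apply: leq_trans leN; apply: ltn_ord.
rewrite [RHS]big_mkcond /=; apply: eq_bigr => i _; case: ltnP => [li|li]; last first.
  by rewrite big1 // => j /eqP; nia.
rewrite [RHS](big_ord_widen_cond N (fun j => i * r + j * s == l)%N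
  (fun j => c i j *: (X ^+ i * Y ^+ j))); last first.
  by apply: leq_trans leN; apply: ltn_ord.
apply: eq_bigl => j; apply/idP/andP => [/eqP E|[]//]; split; first exact/eqP.
by nia.
Qed.

End PowerSeriesSubring.

(** * From modules over power series to finite modules *)

Section RowNat.
Variables (F : finFieldType) (n : nat).

(** The default value beyond [n] makes the layers of a truncation a sequence. *)
Definition row_nat i (A : 'M[F]_(n, 2)) : 'rV[F]_2 :=
  if insub i is Some j then row j A else 0.

Lemma row_nat_linear i : linear (row_nat i).
Proof.
move=> c A B; rewrite /row_nat; case: insub => [j|]; first exact: linearP.
by rewrite scaler0 addr0.
Qed.

HB.instance Definition _ i :=
  GRing.isLinear.Build F 'M[F]_(n, 2) 'rV[F]_2 *:%R (row_nat i) (row_nat_linear i).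

Lemma row_natE i A (lt : (i < n)%N) : row_nat i A = row (Ordinal lt) A.
Proof. by rewrite /row_nat insubT. Qed.

Lemma row_nat0 i A : (n <= i)%N -> row_nat i A = 0.
Proof. by move=> le; rewrite /row_nat insubN // -leqNgt. Qed.

End RowNat.

Section Transport.
Variables (F : finFieldType) (O : comAlgType F) (z : O) (Om : lmodType O) (X Y : O).
Variables (r s C ex : nat) (cO : nat -> Om -> 'rV[F]_2) (g h : 'M[F]_2).

Definition ovanish i (v : Om) := forall j, (j < i)%N -> cO j v = 0.

(** The leading terms of [leading_terms], before truncation. The filtration is the
    one by the powers of [zeta = z ^+ ex]: [ex = 2] for the cable, where the two
    coordinates of a layer are the coefficients of an even and an odd power of
    [z], and [ex = 1] for the two-branch ring and in rank two. *)
Record leading_data : Prop := {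
  data_add : forall i u v, cO i (u + v) = cO i u + cO i v;
  data_scale : forall i (c : F) v, cO i (c%:A *: v) = c *: cO i v;
  data_onto : forall A : nat -> 'rV[F]_2, exists v, forall i, cO i v = A i;
  data_filter : forall i v, ovanish i v <-> exists w, v = z ^+ (ex * i) *: w;
  data_ex : (0 < ex)%N;
  data_x : forall i v, ovanish i v -> ovanish (i + r) (X *: v) /\ cO (i + r) (X *: v) = cO i v *m g;
  data_y : forall i v, ovanish i v -> ovanish (i + s) (Y *: v) /\ cO (i + s) (Y *: v) = cO i v *m h;
  data_xdiv : forall i v, ovanish (i + r) v -> exists2 u, ovanish i u & v = X *: u;
  data_gh : g * h = h * g;
  data_xz : exists X', X = z * X';
  data_yz : exists Y', Y = z * Y';
  data_const : forall (c : F) o, c%:A = z * o -> c = 0 }.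

Hypothesis od : leading_data.
Hypotheses (r_gt0 : (0 < r)%N) (s_gt0 : (0 < s)%N).

Lemma cO0 i : cO i 0 = 0.
Proof. by rewrite -(scaler0 Om (0%:A : O)) (data_scale od) scale0r. Qed.

Lemma cON i v : cO i (- v) = - cO i v.
Proof. by apply/eqP; rewrite -addr_eq0 -(data_add od) addNr cO0. Qed.

Lemma cO_sum (I : Type) (t : seq I) (P : pred I) i (f : I -> Om) :
  cO i (\sum_(j <- t | P j) f j) = \sum_(j <- t | P j) cO i (f j).
Proof. by elim/big_rec2: _ => [|j A v _ <-]; rewrite ?cO0 ?(data_add od). Qed.

Lemma ovanish_monomial a b i v : ovanish i v ->
  ovanish (i + a * r + b * s) (X ^+ a * Y ^+ b *: v) /\
  cO (i + a * r + b * s) (X ^+ a * Y ^+ b *: v) = cO i v *m (g ^+ a * h ^+ b).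
Proof.
move=> vi; rewrite -scalerA addnAC.
have [vy ly] : ovanish (i + b * s) (Y ^+ b *: v) /\
    cO (i + b * s) (Y ^+ b *: v) = cO i v *m (h ^+ b).
  elim: b => [|b [vb lb]]; first by rewrite addn0 scale1r mulmx1.
  rewrite mulSn [(s + _)%N]addnC addnA exprS -scalerA.
  by have [vb' ->] := data_y od vb; split=> //; rewrite lb exprSr mulmxA.
have -> : g ^+ a * h ^+ b = h ^+ b * g ^+ a.
  by apply: commrX; apply: commr_sym; apply: commrX; apply: commr_sym; apply: data_gh od.
elim: a => [|a [va la]]; first by rewrite addn0 scale1r mulr1 ly.
rewrite mulSn [(r + _)%N]addnC addnA exprS -scalerA.
by have [va' ->] := data_x od va; split=> //; rewrite la exprSr !mulmxA.
Qed.

Hypothesis conductor : forall o, power_series_ring z X Y (z ^+ (ex * C) * o).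

(* Every standard module [M] contains the degrees at least [C], so [X *: M]
   contains those at least [C + r]: truncation in degree [n] loses neither [M]
   nor its product with the maximal ideal. *)
Let n := (C + r)%N.
Let E := 'M[F]_(n, 2).
Let R := power_series_ring z X Y.

Definition proj (v : Om) : E := \matrix_i cO i v.

Lemma row_nat_proj i v : (i < n)%N -> row_nat i (proj v) = cO i v.
Proof. by move=> lt; rewrite (row_natE _ lt) rowK. Qed.

Lemma projD u v : proj (u + v) = proj u + proj v.
Proof. by apply/row_matrixP=> i; rewrite linearD /= !rowK (data_add od). Qed.

Lemma projZ (c : F) v : proj (c%:A *: v) = c *: proj v.
Proof. by apply/row_matrixP=> i; rewrite linearZ /= !rowK (data_scale od). Qed.

Lemma projB u v : proj (u - v) = proj u - proj v.
Proof.
apply/row_matrixP=> i; rewrite linearB /= !rowK (data_add od).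
by rewrite cON.
Qed.

Lemma proj0 : proj 0 = 0.
Proof. by rewrite -(subrr (0 : Om)) projB subrr. Qed.

Lemma proj_sum (I : Type) (t : seq I) (P : pred I) (f : I -> Om) :
  proj (\sum_(i <- t | P i) f i) = \sum_(i <- t | P i) proj (f i).
Proof. by elim/big_rec2: _ => [|i A v _ <-]; rewrite ?proj0 ?projD. Qed.

Lemma proj_eq0 v : proj v = 0 <-> ovanish n v.
Proof.
split=> [v0 i lt|v0]; first by rewrite -row_nat_proj // v0 linear0.
by apply/row_matrixP=> i; rewrite rowK row0 v0.
Qed.

Lemma proj_onto A : exists v, proj v = A.
Proof.
have [v Hv] := data_onto od (fun i => row_nat i A).
exists v; apply/row_matrixP=> i; rewrite rowK Hv (row_natE _ (ltn_ord i)).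
by congr row; apply: val_inj.
Qed.

Definition section_of A : Om := projT1 (cid (proj_onto A)).
Lemma section_ofK A : proj (section_of A) = A. Proof. exact: projT2 (cid (proj_onto A)). Qed.

Definition opE (f : O) (A : E) : E := proj (f *: section_of A).

Lemma ovanish_scale f v : ovanish n v -> ovanish n (f *: v).
Proof.
move=> /(data_filter od)[w ->]; apply/(data_filter od).
by exists (f *: w); rewrite !scalerA mulrC.
Qed.

Lemma proj_op f v : proj (f *: v) = opE f (proj v).
Proof.
apply/eqP; rewrite -subr_eq0 -projB -scalerBr; apply/eqP/proj_eq0/ovanish_scale.
by apply/proj_eq0; rewrite projB section_ofK subrr.
Qed.

Lemma opE_linear f : linear (opE f).
Proof.
move=> c A B; rewrite -[in LHS](section_ofK A) -[in LHS](section_ofK B).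
rewrite -projZ -projD -proj_op scalerDr [f *: (c%:A *: _)]scalerA mulrC -scalerA.
by rewrite projD projZ !proj_op !section_ofK.
Qed.

HB.instance Definition _ f :=
  GRing.isLinear.Build F E E *:%R (opE f) (opE_linear f).

Let xE : {linear E -> E} := opE X.
Let yE : {linear E -> E} := opE Y.

Lemma vanish_section i A : vanish (@row_nat F n) i A -> (i <= n)%N ->
  ovanish i (section_of A).
Proof.
move=> vi le j lt; rewrite -row_nat_proj ?section_ofK ?vi //.
exact: leq_trans le.
Qed.

Lemma vanish_ge i A : vanish (@row_nat F n) i A -> (n <= i)%N -> A = 0.
Proof.
move=> vi le; apply/row_matrixP=> j.
have := vi j (leq_trans (ltn_ord j) le); rewrite row0 => <-.
by rewrite /= (row_natE _ (ltn_ord j)); congr row; apply: val_inj.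
Qed.

Lemma transport_leading_terms :
  leading_terms xE yE r s n (@row_nat F n) g h.
Proof.
have vanish_op f d i A : (forall i v, ovanish i v -> ovanish (i + d) (f *: v)) ->
    vanish (@row_nat F n) i A -> vanish (@row_nat F n) (i + d) (opE f A).
  move=> Hf vi; have [le|/ltnW le] := leqP i n; last first.
    by rewrite (vanish_ge vi le) linear0 => j _; rewrite linear0.
  move=> j lt; have [lj|lj] := leqP n j; first by rewrite /= row_nat0.
  by rewrite /= /opE row_nat_proj //; apply: (Hf i) => //; apply: vanish_section.
split=> //.
- move=> v; rewrite -[v]section_ofK /xE /yE /= -!proj_op !scalerA mulrC //.
- by move=> v v0; apply: vanish_ge v0 _.
- move=> i w lt; exists (\matrix_j (if j == i :> nat then w else 0)).
    by rewrite /= (row_natE _ lt) rowK eqxx.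
  move=> j ji; have [le|lj] := leqP n j; first by rewrite /= row_nat0.
  by rewrite /= (row_natE _ lj) rowK /= (negPf ji).
- by move=> i v; apply: vanish_op => {}i {}v /(data_x od)[].
- by move=> i v; apply: vanish_op => {}i {}v /(data_y od)[].
- move=> i v vi lt; rewrite /= /opE row_nat_proj //.
  have le : (i < n)%N by apply: leq_ltn_trans lt; apply: leq_addr.
  by case: (data_x od (vanish_section vi (ltnW le))) => _ ->; rewrite -row_nat_proj // section_ofK.
- move=> i v vi lt; rewrite /= /opE row_nat_proj //.
  have le : (i < n)%N by apply: leq_ltn_trans lt; apply: leq_addr.
  by case: (data_y od (vanish_section vi (ltnW le))) => _ ->; rewrite -row_nat_proj // section_ofK.
- exact: data_gh od.
Qed.

Definition preim (M : {set E}) : set Om := fun v => proj v \in M.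

Lemma quot_dim_preim (U V : {set E}) :
  subspace U -> subspace V -> V \subset U ->
  quot_dim (F := F) (preim U) (preim V) = ldim U V.
Proof.
move=> sU sV VU.
have proj_comb k (c : 'I_k -> F) (e : 'I_k -> Om) :
    proj (\sum_i (c i)%:A *: e i) = \sum_i c i *: proj (e i).
  by rewrite proj_sum; apply: eq_bigr => i _; rewrite projZ.
have dimE k e : basis_mod (preim U) (preim V) (n := k) e -> ldim U V = k.
  case=> eU eS eF; apply: ldimE; first exact: subspace_gt0.
  apply: (card_basis (e := fun i => proj (e i)) sU sV VU) => // [u Uu|c Vc].
    have [|c Vc] := eS (section_of u); first by rewrite /preim section_ofK.
    by exists c; move: Vc; rewrite /preim projB section_ofK proj_comb.
  by apply: eF; rewrite /preim proj_comb.
have [k [e [eU eS eF]]] := subspace_basis sU sV VU.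
have Hk : basis_mod (preim U) (preim V) (fun i : 'I_k => section_of (e i)).
  have projE (c : 'I_k -> F) : \sum_i c i *: proj (section_of (e i)) = \sum_i c i *: e i.
    by apply: eq_bigr => i _; rewrite section_ofK.
  split=> [i|u Uu|c Vc].
  - by rewrite /preim section_ofK.
  - have [c Vc] := eS _ Uu; exists c; by rewrite /preim projB proj_comb projE.
  - by apply: eF; rewrite -projE -proj_comb.
apply: xget_unique.
  by rewrite (dimE _ _ Hk); exists (fun i => section_of (e i)).
by move=> k' [e' He']; rewrite (dimE _ _ He').
Qed.

Lemma proj_monomial i j v :
  proj (X ^+ i * Y ^+ j *: v) = iter i xE (iter j yE (proj v)).
Proof.
rewrite -scalerA; have -> : iter j yE (proj v) = proj (Y ^+ j *: v).
  elim: j => [|j IH] /=; first by rewrite scale1r.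
  by rewrite IH -proj_op scalerA -exprS.
elim: i => [|i IH] /=; first by rewrite scale1r.
by rewrite exprS -[(X * _) *: _]scalerA proj_op IH.
Qed.

Lemma proj_power_series f : R f -> exists (c : nat -> nat -> F) N o,
  f = \sum_(i < N) \sum_(j < N) c i j *: (X ^+ i * Y ^+ j) + z * o /\
  forall v, proj (f *: v) =
    \sum_(i < N) \sum_(j < N) c i j *: iter i xE (iter j yE (proj v)).
Proof.
move=> Rf; have [c [N [o Ef]]] := power_series_approx (ex * n)%N Rf.
have en : (0 < ex * n)%N by rewrite muln_gt0 (data_ex od) /n addn_gt0 r_gt0 orbT.
exists c, N, (z ^+ (ex * n).-1 * o); split.
  by rewrite mulrA -exprS prednK.
move=> v; rewrite Ef scalerDl projD.
have -> : proj ((z ^+ (ex * n) * o) *: v) = 0.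
  by apply/proj_eq0/(data_filter od); exists (o *: v); rewrite scalerA.
rewrite addr0 scaler_suml proj_sum; apply: eq_bigr => i _.
rewrite scaler_suml proj_sum; apply: eq_bigr => j _.
by rewrite -mulr_algl -scalerA projZ proj_monomial.
Qed.

Lemma iter_in (M : {set E}) i j A : xy_submodule xE yE M -> A \in M ->
  iter i xE (iter j yE A) \in M.
Proof.
case/xy_submoduleP=> _ Mx My MA.
have : iter j yE A \in M by elim: j => //= j; apply: My.
by move: (iter j yE A) => B MB; elim: i => //= i; apply: Mx.
Qed.

Lemma preim_stable (M : {set E}) f v : xy_submodule xE yE M -> R f ->
  preim M v -> preim M (f *: v).
Proof.
move=> sM Rf Mv; have [c [N [o [_ Ef]]]] := proj_power_series Rf.
have [sub _ _] := xy_submoduleP _ _ _ sM.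
rewrite /preim Ef; apply: subspace_sum => // i _; apply: subspace_sum => // j _.
by apply: subspaceZ => //; apply: iter_in.
Qed.

(** An element of the maximal ideal has no constant term: it is divisible by [z], as
    are all other monomials, and [z] divides no nonzero constant. *)
Lemma preim_maximal (M : {set E}) f v : xy_submodule xE yE M -> max_ideal z R f ->
  preim M v -> preim (xy_product xE yE M) (f *: v).
Proof.
move=> sM [Rf [f' _ Ef']] Mv; have [c [N [o [Ef Hf]]]] := proj_power_series Rf.
have [sub Mx My] := xy_submoduleP _ _ _ sM.
have sR := xy_product_subspace xE yE sub.
have [X' EX] := data_xz od; have [Y' EY] := data_yz od.
have mon_z i j : (0 < i + j)%N -> exists u, X ^+ i * Y ^+ j = z * u.
  case: i => [|i] ij.
    case: j ij => // j _; exists (Y' * Y ^+ j); by rewrite mul1r exprS {1}EY mulrA.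
  by exists (X' * X ^+ i * Y ^+ j); rewrite exprS {1}EX !mulrA.
have zD u1 u2 : (exists o, u1 = z * o) -> (exists o, u2 = z * o) -> exists o, u1 + u2 = z * o.
  by move=> [o1 ->] [o2 ->]; exists (o1 + o2); rewrite mulrDr.
have c00 : (0 < N)%N -> c 0%N 0%N = 0.
  move=> N0; suff [u Eu] : exists u, (c 0%N 0%N)%:A = z * u by apply: (data_const od Eu).
  have zsum : exists u, \sum_(i < N) \sum_(j < N) c i j *: (X ^+ i * Y ^+ j)
      - (c 0%N 0%N)%:A = z * u.
    rewrite (bigD1 (Ordinal N0)) //= (bigD1 (Ordinal N0)) //=.
    rewrite !expr0 mulr1 addrAC [X in X + _]addrAC subrr add0r addrC.
    apply: (zD).
      elim/big_ind: _ => [|u1 u2|i i0]; [by exists 0; rewrite mulr0 | by apply: (zD) |].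
      elim/big_ind: _ => [|u1 u2|j _]; [by exists 0; rewrite mulr0 | by apply: (zD) |].
      have [|u Eu] := mon_z i j; first by rewrite addn_gt0 lt0n -val_eqE /= in i0 *; rewrite i0.
      by exists (c i j *: u); rewrite Eu scalerAr.
    elim/big_ind: _ => [|u1 u2|j j0]; [by exists 0; rewrite mulr0 | by apply: (zD) |].
    have [|u Eu] := mon_z 0%N j; first by rewrite -val_eqE /= in j0; rewrite lt0n.
    by exists (c 0%N j *: u); rewrite Eu scalerAr.
  case: zsum => u Eu; exists (f' - o - u).
  rewrite !mulrBr -Eu; move: Ef; rewrite -Ef' => ->.
  by rewrite addrK opprB addrC subrK.
rewrite /preim Hf; apply: subspace_sum => // i _; apply: subspace_sum => // j _.
case: i => [[|i] lti] /=; last by apply/subspaceZ/xy_product_mull => //; apply: iter_in.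
case: j => [[|j] ltj] /=; first by rewrite c00 // scale0r subspace0.
by apply/subspaceZ/xy_product_mulr => //; apply: (@iter_in _ 0).
Qed.

Lemma const_in (c : F) : R (c%:A).
Proof. by have := monomial_in z X Y c 0 0; rewrite !expr0 mulr1. Qed.

Lemma x_in : max_ideal z R X.
Proof.
split; first by have := monomial_in z X Y 1 1 0; rewrite scale1r expr0 mulr1.
by have [X' ->] := data_xz od; exists X'.
Qed.

Lemma y_in : max_ideal z R Y.
Proof.
split; first by have := monomial_in z X Y 1 0 1; rewrite scale1r expr0 mul1r.
by have [Y' ->] := data_yz od; exists Y'.
Qed.

Lemma submodule_sum (N : set Om) (I : Type) (t : seq I) (f : I -> Om) :
  submodule R N -> (forall i, N (f i)) -> N (\sum_(i <- t) f i).
Proof. by case=> N0 ND _ Nf; elim/big_ind: _. Qed.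

(** The conductor multiplies the ambient module, which is the [O]-span of the
    standard module, into this module. *)
Lemma standard_conductor (N : set Om) : standard_module R N ->
  forall v, ovanish C v -> N v.
Proof.
case=> sN NT v /(data_filter od)[w ->].
have [k [f [m [_ Nm ->]]]] : module_prod setT N w by rewrite NT.
rewrite scaler_sumr; apply: submodule_sum => // i.
by rewrite scalerA; case: (sN) => _ _; apply; [apply: conductor | apply: Nm].
Qed.

Lemma preim_product (M : {set E}) : xy_submodule xE yE M ->
  (forall v, ovanish C v -> preim M v) ->
  module_prod (max_ideal z R) (preim M) = preim (xy_product xE yE M).
Proof.
move=> sM MC; have [sub _ _] := xy_submoduleP _ _ _ sM.
apply/seteqP; split=> v.
  case=> k [f [m [If Mm ->]]]; rewrite /preim proj_sum.
  apply: subspace_sum; first exact: xy_product_subspace.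
  by move=> i _; apply: preim_maximal.
move=> /xy_productP[A [B [MA MB Ev]]].
(* The error of the lift lies in the truncated degrees, hence in [X *: preim M]. *)
have /(data_xdiv od)[u vu Eu] : ovanish (C + r) (v - (X *: section_of A + Y *: section_of B)).
  by apply/proj_eq0; rewrite projB projD Ev !proj_op !section_ofK subrr.
exists 2%N, (fun i : 'I_2 => if i == 0 then X else Y),
  (fun i : 'I_2 => if i == 0 then section_of A + u else section_of B); split.
- by move=> i; case: ifP => _; [apply: x_in | apply: y_in].
- move=> i; case: ifP => _; rewrite /preim ?projD ?section_ofK //.
  by rewrite subspaceD //; apply: MC.
- rewrite big_ord_recl big_ord1 /= scalerDr -Eu addrAC.
  by rewrite addrC subrK.
Qed.

Section Superpolynomial.
Variables (c : nat) (stdb : {set 'rV[F]_2} -> bool).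
Hypothesis stdP : forall N : set Om, submodule R N -> (forall v, ovanish n v -> N v) ->
  module_prod setT N = setT <-> stdb [set w | `[<exists2 v, N v & cO 0 v = w>]].

Lemma head_preim (M : {set E}) :
  [set w | `[<exists2 v, preim M v & cO 0 v = w>]] = @row_nat F n 0 @: M.
Proof.
have n_gt0 : (0 < n)%N by rewrite /n addn_gt0 r_gt0 orbT.
apply/setP=> w; rewrite inE; apply/asboolP/imsetP => [[v Mv <-]|[A MA ->]].
  by exists (proj v); rewrite ?row_nat_proj.
by exists (section_of A); rewrite /preim ?section_ofK // -row_nat_proj // section_ofK.
Qed.

Lemma preim_submodule (M : {set E}) : xy_submodule xE yE M -> submodule R (preim M).
Proof.
move=> sM; have [sub _ _] := xy_submoduleP _ _ _ sM; split.
- by rewrite /preim proj0 subspace0.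
- by move=> u v Mu Mv; rewrite /preim projD subspaceD.
- by move=> f v Rf Mv; apply: preim_stable.
Qed.

Lemma preim_standard (M : {set E}) : xy_submodule xE yE M ->
  standard_module R (preim M) <-> stdb (@row_nat F n 0 @: M).
Proof.
move=> sM; have [sub _ _] := xy_submoduleP _ _ _ sM.
have MN : forall v, ovanish n v -> preim M v.
  by move=> v /proj_eq0 v0; rewrite /preim v0 subspace0.
rewrite -head_preim -(stdP (preim_submodule sM) MN); split=> [[]//|H].
by split=> //; apply: preim_submodule.
Qed.

Lemma standard_preim (N : set Om) : standard_module R N ->
  exists2 M, xy_submodule xE yE M & N = preim M.
Proof.
move=> stN; case: (stN) => sN _; case: (sN) => N0 ND NR.
have NC := standard_conductor stN.
have Nn v : ovanish n v -> N v.
  by move=> vn; apply: NC => i lt; apply: vn; apply: leq_trans lt _; rewrite leq_addr.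
pose M := [set A : E | `[<N (section_of A)>]].
have MN v : (proj v \in M) = `[<N v>].
  rewrite inE; apply/asboolP/asboolP => Hv.
    rewrite -[v](subrK (section_of (proj v))); apply: ND => //; apply: Nn.
    by apply/proj_eq0; rewrite projB section_ofK subrr.
  rewrite -[section_of _](subrK v); apply: ND => //; apply: Nn.
  by apply/proj_eq0; rewrite projB section_ofK subrr.
exists M; last by apply/funext => v; rewrite /preim MN; apply/propext; rewrite asboolE.
have memM A : A \in M -> N (section_of A) by rewrite inE => /asboolP.
apply/xy_submoduleP; split=> [|A MA|A MA].
- apply/subspaceP; split; first by rewrite -proj0 MN; apply/asboolP.
  move=> a A B MA MB; rewrite -[A]section_ofK -[B]section_ofK -projZ -projD MN; apply/asboolP.
  by apply: ND; [apply: NR; [apply: const_in | apply: memM] | apply: memM].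
- rewrite -[A]section_ofK -[xE _]/(opE X _) -proj_op MN; apply/asboolP; apply: NR; last exact: memM.
  by case: x_in.
- rewrite -[A]section_ofK -[yE _]/(opE Y _) -proj_op MN; apply/asboolP; apply: NR; last exact: memM.
  by case: y_in.
Qed.

Lemma preim_inj (M M' : {set E}) : preim M = preim M' -> M = M'.
Proof.
move=> EM; apply/setP=> A; rewrite -[A]section_ofK.
by have := congr1 (fun N : set Om => N (section_of A)) EM; rewrite /preim => /is_true_inj.
Qed.

Theorem Hmot_transport : Hmot z Om c R =
  \sum_(M : {set E} | xy_submodule xE yE M && stdb (@row_nat F n 0 @: M))
     weight F c (ldim [set: E] M) (ldim M (xy_product xE yE M)).
Proof.
rewrite /Hmot (reindex_fsbig preim
  [set` [pred M : {set E} | xy_submodule xE yE M && stdb (@row_nat F n 0 @: M)]]); last first.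
  split=> [M /= /andP[sM stM]|M M' _ _|N /= stN].
  - exact/preim_standard.
  - exact: preim_inj.
  - have [M sM EN] := standard_preim stN; exists M => //=.
    by apply/andP; split=> //; apply/preim_standard; rewrite -?EN.
rewrite -(bigfs _ (index_enum_uniq _)) => [|M _]; last by rewrite mem_index_enum.
apply: eq_bigr => M /andP[sM stM]; have [sub _ _] := xy_submoduleP _ _ _ sM.
rewrite /weight /rkq preim_product //; last first.
  by apply: standard_conductor; apply/preim_standard.
rewrite -quot_dim_preim ?subsetT ?subspaceT // -quot_dim_preim ?xy_product_subspace //; last first.
  exact: xy_product_sub.
congr (varT ^+ quot_dim _ _ * _).
by apply/seteqP; split=> v // _; rewrite /preim inE.
Qed.

End Superpolynomial.
End Transport.

(** * Superpolynomials from leading terms *)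

Section Rows.
Variable F : finFieldType.

Definition row2 (a b : F) : 'rV[F]_2 := \row_k (if k == 0 then a else b).

Lemma row2_0 a b : row2 a b 0 0 = a. Proof. by rewrite mxE. Qed.
Lemma row2_1 a b : row2 a b 0 1 = b. Proof. by rewrite mxE. Qed.

Lemma row2P (v w : 'rV[F]_2) : v 0 0 = w 0 0 -> v 0 1 = w 0 1 -> v = w.
Proof. by move=> H0 H1; apply/rowP=> i; case: (ord2E i) => ->. Qed.

Lemma row2E (v : 'rV[F]_2) : v = row2 (v 0 0) (v 0 1).
Proof. by apply: row2P; rewrite ?row2_0 ?row2_1. Qed.

Lemma col_row2_unit a b c d : a * d - b * c != 0 ->
  (col_mx (row2 a b) (row2 c d) : 'M_(1 + 1, 2)) \in unitmx.
Proof.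
move=> det0; pose A : 'M_(1 + 1, 2) := col_mx (row2 a b) (row2 c d).
rewrite -row_free_unit; apply/row_freeP.
pose D := a * d - b * c.
pose B : 'M[F]_(2, 1 + 1) :=
  \matrix_(i, j) (D^-1 * (if i == 0 then row2 d (- b) 0 j else row2 (- c) a 0 j)).
exists B.
rewrite mul_col_mx; apply/row_matrixP => i.
have E1 : row2 a b *m B = row2 1 0.
  apply/rowP=> j; rewrite !mxE big_ord_recl big_ord1 !mxE /=.
  case: (ord2E j) => ->; rewrite /= mulrCA [b * _]mulrCA -mulrDr ?mulrN.
    by rewrite -/D mulVf.
  by rewrite [b * a]mulrC addNr mulr0.
have E2 : row2 c d *m B = row2 0 1.
  apply/rowP=> j; rewrite !mxE big_ord_recl big_ord1 !mxE /=.
  case: (ord2E j) => ->; rewrite /= mulrCA [d * _]mulrCA -mulrDr ?mulrN.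
    by rewrite [d * c]mulrC subrr mulr0.
  by rewrite addrC [d * a]mulrC [c * b]mulrC -/D mulVf.
apply/rowP=> j; rewrite E1 E2 !mxE.
by case: (split_ordP i) => i' ->; rewrite ord1 ?(unsplitK (inl _)) ?mxE; case: (ord2E j) => ->.
Qed.

Definition line (c : F) : {set 'rV[F]_2} := [set a *m row2 1 c | a : 'rV[F]_1].

Lemma mem_line c v : (v \in line c) = (v 0 1 == v 0 0 * c).
Proof.
apply/imsetP/eqP => [[a _ ->]|E].
  by rewrite [a]mx11_scalar mul_scalar_mx !mxE mulr1.
exists (v 0 0)%:M; rewrite // mul_scalar_mx; apply: row2P; rewrite mxE ?row2_0 ?row2_1 ?mulr1 //.
Qed.

Lemma line_inj : injective line.
Proof.
move=> c c' E; have : row2 1 c \in line c' by rewrite -E mem_line row2_0 row2_1 mul1r.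
by rewrite mem_line row2_0 row2_1 mul1r => /eqP.
Qed.

Lemma line_neqT c : line c != [set: 'rV[F]_2].
Proof.
apply/eqP=> /setP/(_ (row2 0 1)); rewrite mem_line inE row2_0 row2_1 mul0r.
by rewrite oner_eq0.
Qed.

Lemma full_or_line (L : {set 'rV[F]_2}) v : subspace L -> v \in L -> v 0 0 != 0 ->
  L = [set: 'rV[F]_2] \/ L = line (v 0 1 / v 0 0).
Proof.
move=> sL Lv v0; set c := v 0 1 / v 0 0.
have Lc : row2 1 c \in L.
  have -> : row2 1 c = (v 0 0)^-1 *: v.
    by apply: row2P; rewrite [RHS]mxE ?row2_0 ?row2_1 ?mulVf // mulrC.
  exact: subspaceZ.
have sub_line : line c \subset L.
  apply/fintype.subsetP=> w /imsetP[a _ ->]; rewrite [a]mx11_scalar mul_scalar_mx.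
  exact: subspaceZ.
have [sLc|/fintype.subsetPn[w Lw nw]] := boolP (L \subset line c).
  by right; apply/eqP; rewrite finset.eqEsubset sLc.
left; apply/setP=> x; rewrite inE; set d := w 0 1 - w 0 0 * c.
have d0 : d != 0 by rewrite subr_eq0; rewrite mem_line in nw.
have L01 : row2 0 1 \in L.
  have -> : row2 0 1 = d^-1 *: (w - w 0 0 *: row2 1 c).
    apply: row2P; rewrite !mxE ?row2_0 ?row2_1 /= ?mulr1 ?subrr ?mulr0 //.
    by rewrite -/d mulVf.
  by rewrite subspaceZ // subspaceB // subspaceZ.
have -> : x = x 0 0 *: row2 1 c + (x 0 1 - x 0 0 * c) *: row2 0 1.
  by apply: row2P; rewrite !mxE /= ?mulr1 ?mulr0 ?addr0 // addrC subrK.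
by rewrite subspaceD ?subspaceZ.
Qed.

End Rows.

Section Monomials.
Variables (F : fieldType) (V : lmodType F) (r s : nat).
Hypotheses (r_gt0 : (0 < r)%N) (s_gt0 : (0 < s)%N).

Lemma single_monomial (M : nat -> nat -> V) (c : F) i a0 b0 : (a0 * r + b0 * s)%N = i ->
  \sum_(a < i.+1) \sum_(b < i.+1 | (a * r + b * s == i)%N)
    (if (a == a0 :> nat) && (b == b0 :> nat) then c else 0) *: M a b = c *: M a0 b0.
Proof.
move=> Ei; have lta : (a0 < i.+1)%N by nia.
have ltb : (b0 < i.+1)%N by nia.
rewrite (bigD1 (Ordinal lta)) //= (bigD1 (Ordinal ltb)) /=; last by rewrite Ei.
rewrite !eqxx /= big1 => [|b /andP[_ bb]]; last first.
  by rewrite -val_eqE /= in bb; rewrite (negPf bb) scale0r.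
rewrite big1 ?addr0 // => a aa; rewrite -val_eqE /= in aa.
by rewrite big1 // => b _; rewrite (negPf aa) scale0r.
Qed.

End Monomials.

Section Nakayama.
Variables (F : finFieldType) (O : comAlgType F) (z : O) (Om : lmodType O).
Variable N : set Om.

Lemma module_prod_add u v :
  module_prod setT N u -> module_prod setT N v -> module_prod setT N (u + v).
Proof.
case=> k [f [m [_ Nm ->]]] [k' [f' [m' [_ Nm' ->]]]].
exists (k + k')%N, (fun i => match fintype.split i with inl j => f j | inr j => f' j end),
  (fun i => match fintype.split i with inl j => m j | inr j => m' j end); split=> //.
  by move=> i; case: fintype.split.
rewrite big_split_ord /=; congr (_ + _); apply: eq_bigr => i _.
  by rewrite (unsplitK (inl i)).
by rewrite (unsplitK (inr i)).
Qed.

Lemma module_prod_scale f v : module_prod setT N v -> module_prod setT N (f *: v).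
Proof.
case=> k [f' [m [_ Nm ->]]]; exists k, (fun i => f * f' i), m; split=> //.
by rewrite scaler_sumr; apply: eq_bigr => i _; rewrite scalerA.
Qed.

Lemma module_prod_in f v : N v -> module_prod setT N (f *: v).
Proof.
by move=> Nv; exists 1%N, (fun=> f), (fun=> v); split=> //; rewrite big_ord1.
Qed.

Lemma nakayama k : (forall w, N (z ^+ k *: w)) ->
  (forall v, exists u w, module_prod setT N u /\ v = u + z *: w) ->
  module_prod setT N = setT.
Proof.
move=> Nk gen; apply/seteqP; split=> // v _.
have H i : exists u w, module_prod setT N u /\ v = u + z ^+ i *: w.
  elim: i => [|i [u [w [Pu Ev]]]].
    exists 0, v; split; last by rewrite expr0 scale1r add0r.
    by rewrite -(scale0r (z ^+ k *: 0 : Om)); apply: module_prod_in.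
  have [u' [w' [Pu' Ew]]] := gen w.
  exists (u + z ^+ i *: u'), w'; split.
    by apply: module_prod_add => //; apply: module_prod_scale.
  by rewrite Ev Ew scalerDr scalerA exprSr addrA.
have [u [w [Pu ->]]] := H k; apply: module_prod_add => //.
by rewrite -[X in module_prod _ _ X]scale1r; apply: module_prod_in.
Qed.

End Nakayama.

Lemma char_superpolynomial i : i.+1%:R != 0 :> {poly {poly int}}.
Proof. by rewrite -!polyC_natr !polyC_eq0 Num.Theory.pnatr_eq0. Qed.

Section HmotLines.
Variables (F : finFieldType) (r s : nat).
Hypotheses (r_gt0 : (0 < r)%N) (s_gt0 : (0 < s)%N) (co_rs : coprime r s).

(** The contributions to the superpolynomial of the standard modules [M] whose
    reduction modulo [zeta] is [F ^ 2], and of those whose reduction is a given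
    line. *)
Definition full_part c :=
  quotient_sum (@shiftx F r s (r * s) 2) (@shifty F r s (r * s) 2) 2 (weight F c).
Definition line_part c :=
  quotient_sum (@shiftx F r s (2 * r * s) 1) (@shifty F r s (2 * r * s) 1) 1 (weight F c).

Variables (O : comAlgType F) (z : O) (Om : lmodType O) (X Y : O).
Variables (ex : nat) (cO : nat -> Om -> 'rV[F]_2) (g h : 'M[F]_2).
Hypothesis od : leading_data z X Y r s ex cO g h.
Let C := (2 * r * s)%N.
Hypothesis conductor : forall o, power_series_ring z X Y (z ^+ (ex * C) * o).
Hypotheses (gU : g \in unitmx) (hU : h \in unitmx).

Lemma head_subspace (N : set Om) : submodule (power_series_ring z X Y) N ->
  subspace [set w | `[<exists2 v, N v & cO 0 v = w>]].
Proof.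
case=> N0 ND NR; apply/subspaceP; split.
  by rewrite inE; apply/asboolP; exists 0; rewrite ?(cO0 od).
move=> c u v; rewrite !inE => -[u' Nu <-] [v' Nv <-].
exists (c%:A *: u' + v'); last by rewrite (data_add od) (data_scale od).
by apply: ND => //; apply: NR => //; apply: const_in.
Qed.

(** Standardness only depends on the reduction [L] of the module modulo [zeta]; [Cs]
    is the set of slopes of the admissible lines, all of which contribute the
    same sum. *)
Theorem Hmot_lines c (Cs : {set F}) :
  (forall d, d \in Cs ->
    (col_mx (row2 1 d *m h ^+ r) (row2 1 d *m g ^+ s) : 'M_(1 + 1, 2)) \in unitmx) ->
  (forall N : set Om, submodule (power_series_ring z X Y) N ->
     (forall v, ovanish cO (C + r) v -> N v) ->
     let L := [set w | `[<exists2 v, N v & cO 0 v = w>]] in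
     module_prod setT N = setT <-> (L == [set: 'rV[F]_2]) || [exists d in Cs, L == line d]) ->
  Hmot z Om c (power_series_ring z X Y) = full_part c + line_part c *+ #|Cs|.
Proof.
move=> eU stdP.
pose stdb (L : {set 'rV[F]_2}) := (L == [set: 'rV[F]_2]) || [exists d in Cs, L == line d].
apply: etrans (Hmot_transport od r_gt0 conductor c (stdb := stdb) stdP) _.
have lt := transport_leading_terms C od.
have nC : (C <= C + r)%N by apply: leq_addr.
pose hd (M : {set 'M[F]_(C + r, 2)}) := @row_nat F (C + r) 0 @: M.
rewrite (bigID (fun M => hd M == [set: 'rV[F]_2])) /=; congr (_ + _).
  apply: etrans _ (sum_full_head r_gt0 s_gt0 co_rs gU hU nC lt (weight F c)
    char_superpolynomial).
  apply: eq_bigl => M; rewrite -andbA; congr (_ && _).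
  by apply: andb_idl => /eqP hM; rewrite /stdb -/(hd M) hM eqxx.
have lineE d : d \in Cs -> line_part c =
    \sum_(M | xy_submodule (opE od X) (opE od Y) M && (hd M == line d))
      weight F c (ldim [set: 'M[F]_(C + r, 2)] M)
        (ldim M (xy_product (opE od X) (opE od Y) M)).
  move=> Cd; apply/esym.
  exact: (sum_line_head r_gt0 s_gt0 co_rs gU hU nC lt (weight F c)
    char_superpolynomial (eU d Cd)).
rewrite -sumr_const (eq_bigr _ lineE).
rewrite (exchange_big_dep (fun M => xy_submodule (opE od X) (opE od Y) M &&
    stdb (hd M) && (hd M != [set: 'rV[F]_2]))) /=; last first.
  move=> d M Cd /andP[-> /eqP hM] /=; rewrite /stdb hM (negPf (line_neqT d)) /= andbT.
  by apply/existsP; exists d; rewrite Cd eqxx.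
apply: eq_bigr => M /andP[/andP[sM stM] nT].
rewrite /stdb (negPf nT) /= in stM; case/existsP: stM => d /andP[Cd /eqP hM].
rewrite (big_pred1 d) // => d'; rewrite sM /= (hM : hd M = _).
apply/andP/eqP => [[_ /eqP/line_inj->]//|->].
by rewrite Cd eqxx.
Qed.

End HmotLines.

Section ConductorOfRankOne.
Variables (F : finFieldType) (r s : nat).
Hypotheses (r_gt0 : (0 < r)%N) (s_gt0 : (0 < s)%N) (co_rs : coprime r s).
Variables (O : comAlgType F) (z : O) (X Y : O).
Variables (ex : nat) (cO : nat -> O^o -> 'rV[F]_2) (g h : 'M[F]_2).
Hypothesis od : leading_data (Om := O^o) z X Y r s ex cO g h.
Hypotheses (gU : g \in unitmx) (hU : h \in unitmx).
Hypothesis eU :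
  (col_mx (cO 0 1 *m h ^+ r) (cO 0 1 *m g ^+ s) : 'M_(1 + 1, 2)) \in unitmx.

Lemma monomial_leading a b : ovanish (Om := O^o) cO (a * r + b * s) (X ^+ a * Y ^+ b) /\
  cO (a * r + b * s) (X ^+ a * Y ^+ b) = cO 0 1 *m (g ^+ a * h ^+ b).
Proof.
have := ovanish_monomial od a b (i := 0) (v := 1).
by rewrite !add0n /GRing.scale /= mulr1; apply.
Qed.

(** From degree [2 * r * s] on, each degree has the two monomials
    [X^a Y^(b + r)] and [X^(a + s) Y^b], whose leading terms span the layer. *)
Lemma conductor_rank_one o : power_series_ring z X Y (z ^+ (ex * (2 * r * s)) * o).
Proof.
pose Fil i (f : O) := ovanish (Om := O^o) cO i f.
have zE (f f' : O^o) (i : nat) : cO i (f - f') = cO i f - cO i f'.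
  by rewrite (data_add od) (cON od).
have sE (c : F) (f : O) i : cO i (c *: f) = c *: cO i f.
  by rewrite -mulr_algl; apply: (data_scale od).
apply: (@successive_approximation _ _ _ _ _ r s (2 * r * s) ex Fil) => //.
- exact: data_ex od.
- by move=> i f f' Hf Hf' j lt; rewrite zE Hf // Hf' // subrr.
- by move=> i c f Hf j lt; rewrite sE Hf // scaler0.
- by move=> i f Hf j lt; apply: Hf; apply: leq_trans lt _.
- by move=> i f /(data_filter od)[w Ew]; exists w; rewrite Ew.
- by move=> a b; case: (monomial_leading a b).
- move=> i f le Hf.
  case: (gap_or_rep r_gt0 s_gt0 co_rs i) => [[a [b Eab]]|[a [b Eab]]]; last by nia.
  have [a0 [b0 [a0s E0 _]]] := rep_canonical r_gt0 s_gt0 co_rs a b.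
  have le_r : (r <= b0)%N by nia.
  pose Q := g ^+ a0 * h ^+ (b0 - r).
  have QU : Q \in unitmx by apply: monomial_unit.
  pose W := (col_mx (cO 0 1 *m h ^+ r) (cO 0 1 *m g ^+ s) : 'M_(1 + 1, 2)).
  pose c : 'rV[F]_(1 + 1) := cO i f *m invmx (W *m Q).
  pose c1 := lsubmx c 0 0; pose c2 := rsubmx c 0 0.
  pose coef a b := (if (a == a0) && (b == b0) then c1 else 0)
    + (if (a == a0 + s)%N && (b == b0 - r)%N then c2 else 0).
  exists coef.
  have Ei2 : ((a0 + s) * r + (b0 - r) * s)%N = i by nia.
  have -> : \sum_(a < i.+1) \sum_(b < i.+1 | (a * r + b * s == i)%N) coef a b *: (X ^+ a * Y ^+ b)
    = c1 *: (X ^+ a0 * Y ^+ b0) + c2 *: (X ^+ (a0 + s) * Y ^+ (b0 - r)).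
    rewrite -(single_monomial r_gt0 s_gt0 (fun a b => X ^+ a * Y ^+ b) c1 (etrans E0 Eab)).
    rewrite -(single_monomial r_gt0 s_gt0 (fun a b => X ^+ a * Y ^+ b) c2 Ei2).
    rewrite -big_split; apply: eq_bigr => a' _; rewrite -big_split; apply: eq_bigr => b' _.
    by rewrite /= -scalerDl.
  have [v1 l1] := monomial_leading a0 b0; rewrite E0 Eab in v1 l1.
  have [v2 l2] := monomial_leading (a0 + s) (b0 - r); rewrite Ei2 in v2 l2.
  move=> j; rewrite ltnS leq_eqVlt zE (data_add od) !sE => /predU1P[->|lt]; last first.
    by rewrite Hf // v1 // v2 // !scaler0 addr0 subrr.
  rewrite l1 l2; apply/eqP; rewrite subr_eq0; apply/eqP.
  have -> : cO i f = c *m (W *m Q) by rewrite mulmxKV // unitmx_mul eU QU.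
  rewrite mul_col_mx -{1}[c]hsubmxK mul_row_col.
  have -> : lsubmx c = c1%:M by rewrite [LHS]mx11_scalar.
  have -> : rsubmx c = c2%:M by rewrite [LHS]mx11_scalar.
  have -> : g ^+ a0 * h ^+ b0 = h ^+ r *m Q.
    by have := monomialDh r (data_gh od) a0 (b0 - r); rewrite subnK.
  have -> : g ^+ (a0 + s) * h ^+ (b0 - r) = g ^+ s *m Q.
    by have := monomialDg s (data_gh od) a0 (b0 - r).
  by rewrite !mul_scalar_mx !mulmxA.
- by apply/(data_filter od); exists o.
Qed.

End ConductorOfRankOne.

(** * The cable *)

Section Coefficients.
Variable F : finFieldType.
Implicit Types f g : fps F.

Lemma fcoefD f g i : fcoef (f + g) i = fcoef f i + fcoef g i. Proof. by []. Qed.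
Lemma fcoefB f g i : fcoef (f - g) i = fcoef f i - fcoef g i. Proof. by []. Qed.
Lemma fcoefZ (c : F) f i : fcoef (c *: f) i = c * fcoef f i. Proof. by []. Qed.
Lemma fcoef1 i : fcoef (1 : fps F) i = (i == 0%N)%:R. Proof. by []. Qed.

Lemma fcoef_mul0 f g : fcoef (f * g) 0 = fcoef f 0 * fcoef g 0.
Proof.
have -> : fcoef (f * g) 0 = \sum_(j < 1) fcoef f j * fcoef g (0 - j)%N by [].
by rewrite big_ord1.
Qed.

Lemma fcoef_mulX f i : fcoef (fpsX F * f) i = if i is i'.+1 then fcoef f i' else 0.
Proof.
have -> : fcoef (fpsX F * f) i = \sum_(j < i.+1) (nat_of_ord j == 1%N)%:R * fcoef f (i - j)%N.
  by [].
rewrite big_ord_recl /= mul0r add0r.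
case: i => [|i]; first by rewrite big_ord0.
rewrite big_ord_recl /= mul1r subn1 /= big1 ?addr0 // => j _.
by rewrite mul0r.
Qed.

Lemma fcoef_mulXn n f i :
  fcoef (fpsX F ^+ n * f) i = if (i < n)%N then 0 else fcoef f (i - n).
Proof.
elim: n i => [|n IH] i; first by rewrite expr0 mul1r subn0.
rewrite exprS -mulrA fcoef_mulX; by case: i.
Qed.

Lemma fps_divisible n f : (forall j, (j < n)%N -> fcoef f j = 0) ->
  exists g, f = fpsX F ^+ n * g.
Proof.
move=> f0; exists (Fps (fun i => fcoef f (i + n))); apply: fpsP => i.
by rewrite fcoef_mulXn; case: ltnP => [/f0//|le] /=; rewrite subnK.
Qed.

Lemma fps_divisibleP n f : (forall j, (j < n)%N -> fcoef f j = 0) <->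
  exists g, f = fpsX F ^+ n * g.
Proof.
by split=> [/fps_divisible//|[g ->] j lt]; rewrite fcoef_mulXn lt.
Qed.

Lemma fps_regularE (f : fps F) (v : (fps F)^o) : f *: v = f * v. Proof. by []. Qed.

Lemma fps_constE (c : F) (v : fps F) : c%:A * v = c *: v.
Proof. exact: mulr_algl. Qed.

End Coefficients.

Section Cable.
Variables (F : finFieldType) (r s : nat) (u : F).
Hypotheses (r_gt0 : (0 < r)%N) (s_gt0 : (0 < s)%N) (co_rs : coprime r s).

Let z := fpsX F.
Let X := z ^+ (2 * r).
Let Y := z ^+ (2 * s) + u *: z ^+ (2 * s).+1.

(** Power series in [z] as a free module over power series in [z ^ 2], with basis
    [1, z]. *)
Definition cable_layer i (f : (fps F)^o) : 'rV[F]_2 :=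
  row2 (fcoef f (2 * i)) (fcoef f (2 * i).+1).

(** Multiplication by [1 + u z] on a layer. *)
Definition shear : 'M[F]_2 := 1 + u *: delta_mx 0 1.

Lemma row2_shear (v : 'rV[F]_2) : v *m shear = row2 (v 0 0) (v 0 1 + u * v 0 0).
Proof.
rewrite mulmxDr mulmx1 -scalemxAr.
by apply: row2P; rewrite !mxE !big_ord_recl big_ord0 !mxE /= !(mulr0, mulr1, addr0).
Qed.

Lemma shear_pow a b n : row2 a b *m shear ^+ n = row2 a (b + n%:R * u * a).
Proof.
elim: n => [|n IH]; first by rewrite mulmx1 !mul0r addr0.
rewrite exprSr -mulmxE mulmxA IH row2_shear row2_0 row2_1 -natr1 !mulrDl mul1r.
by rewrite addrA.
Qed.

Lemma shear_unit : shear \in unitmx.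
Proof.
suff /mulmx1_unit[] : shear *m (1 - u *: delta_mx 0 1) = 1%:M by [].
rewrite mulmxDl mulmxBr !mulmx1 mul1mx mulmxBr mulmx1 -scalemxAl -scalemxAr.
by rewrite mul_delta_mx_0 // !scaler0 subr0 addrNK.
Qed.

Lemma cable_vanishP i (f : (fps F)^o) :
  ovanish cable_layer i f <-> forall m, (m < 2 * i)%N -> fcoef f m = 0.
Proof.
split=> [vi m lt|f0 j lt]; last first.
  by apply: row2P; rewrite ?row2_0 ?row2_1 mxE f0 //; lia.
have lt2 : (m./2 < i)%N by lia.
have Em : m = (odd m + 2 * m./2)%N by rewrite mul2n odd_double_half.
have /rowP v2 := vi _ lt2; rewrite [in LHS]Em; case: (odd m).
  by have := v2 1; rewrite /cable_layer row2_1 mxE.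
by have := v2 0; rewrite /cable_layer row2_0 mxE.
Qed.

Lemma cable_leading : leading_data (Om := (fps F)^o) z X Y r s 2 cable_layer 1 shear.
Proof.
split.
- by move=> i f g; apply: row2P; rewrite [RHS]mxE ?row2_0 ?row2_1.
- move=> i c f; rewrite fps_regularE fps_constE.
  by apply: row2P; rewrite [RHS]mxE ?row2_0 ?row2_1.
- move=> A; exists (Fps (fun m => if odd m then A m./2 0 1 else A m./2 0 0)) => i.
  by apply: row2P; rewrite ?row2_0 ?row2_1 /= mul2n odd_double /= ?uphalf_double ?doubleK.
- move=> i v; split=> [/cable_vanishP/fps_divisible[f ->]|[f ->]]; first by exists f.
  by apply/cable_vanishP/fps_divisibleP; exists f.
- by [].
- move=> i v /cable_vanishP v0; rewrite fps_regularE; split.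
    apply/cable_vanishP => m lt; rewrite fcoef_mulXn; case: ltnP => // le.
    by apply: v0; lia.
  rewrite mulmx1; apply: row2P; rewrite ?row2_0 ?row2_1 fcoef_mulXn mulnDr.
    by rewrite ltnNge leq_addl /= addnK.
  by rewrite -addSn ltnNge leq_addl /= addnK.
- move=> i v /cable_vanishP v0; rewrite fps_regularE; split.
    apply/cable_vanishP => m lt; rewrite mulrDl -scalerAl fcoefD fcoefZ !fcoef_mulXn.
    by case: ltnP => le1; case: ltnP => le2; rewrite ?v0 ?mulr0 ?addr0 //; lia.
  rewrite row2_shear.
  apply: row2P; rewrite ?row2_0 ?row2_1 mulrDl -scalerAl fcoefD fcoefZ !fcoef_mulXn.
    have -> : (2 * (i + s) < 2 * s)%N = false by lia.
    have -> : (2 * (i + s) - 2 * s = 2 * i)%N by lia.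
    case: ltnP => le; first by rewrite mulr0 addr0.
    by rewrite (v0 (2 * (i + s) - (2 * s).+1)%N) ?mulr0 ?addr0 //; lia.
  have -> : ((2 * (i + s)).+1 < 2 * s)%N = false by lia.
  have -> : ((2 * (i + s)).+1 < (2 * s).+1)%N = false by lia.
  have -> : ((2 * (i + s)).+1 - 2 * s = (2 * i).+1)%N by lia.
  by have -> : ((2 * (i + s)).+1 - (2 * s).+1 = 2 * i)%N by lia.
- move=> i v /cable_vanishP/fps_divisible[f ->].
  exists (z ^+ (2 * i) * f).
    by apply/cable_vanishP/fps_divisibleP; exists f.
  by rewrite fps_regularE mulrA -exprD addnC mulnDr.
- by rewrite mul1r mulr1.
- by exists (z ^+ (2 * r).-1); rewrite -exprS prednK // muln_gt0.
- exists (z ^+ (2 * s).-1 + u *: z ^+ (2 * s)).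
  by rewrite mulrDr -scalerAr -!exprS prednK // muln_gt0.
- move=> c o /(congr1 (fun f => fcoef f 0)); rewrite fcoef_mulX fcoefZ fcoef1 mulr1.
  by [].
Qed.

Lemma cable_layer1 : cable_layer 0 1 = row2 1 0.
Proof. by apply: row2P; rewrite ?row2_0 ?row2_1. Qed.

Hypothesis ru : r%:R * u != 0.

Lemma cable_line_unit d :
  (col_mx (row2 1 d *m shear ^+ r) (row2 1 d *m 1 ^+ s) : 'M_(1 + 1, 2)) \in unitmx.
Proof.
rewrite expr1n mulmx1 shear_pow; apply: col_row2_unit.
by rewrite mul1r !mulr1 opprD addrA subrr add0r oppr_eq0.
Qed.

(** A module spans [F[[z]]] when it contains a unit. Hence the admissible lines are
    the [#|F|] ones other than the line of [z]. *)
Lemma Hmot_cableE : Hmot_cable r s u = full_part F r s 1 + line_part F r s 1 *+ #|F|.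
Proof.
have cond := conductor_rank_one r_gt0 s_gt0 co_rs cable_leading (unitmx1 _ _) shear_unit.
rewrite cable_layer1 in cond; have {}cond := cond (cable_line_unit 0).
rewrite -cardsT.
apply: (Hmot_lines r_gt0 s_gt0 co_rs cable_leading cond (unitmx1 _ _) shear_unit)
  => [d _|N sN Nn L].
  exact: cable_line_unit.
case: (sN) => N0 ND NR.
have sL : subspace L := head_subspace cable_leading sN.
have memL v : N v -> cable_layer 0 v \in L.
  by move=> Nv; rewrite inE; apply/asboolP; exists v.
split=> [NT|HL].
  have [v Nv v0] : exists2 v, N v & fcoef v 0 != 0.
    apply: contrapT => H; have : module_prod setT N (1 : (fps F)^o) by rewrite NT.
    case=> k [f [m [_ Nm]]] E1.
    have : fcoef (1 : fps F) 0 = 0.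
      rewrite E1; elim/big_ind: _ => [//|a b Ha Hb|i _]; first by rewrite fcoefD Ha Hb addr0.
      have m0 : fcoef (m i) 0 = 0.
        by apply/eqP; apply: contrapT => /negP m0; apply: H; exists (m i).
      by rewrite fps_regularE fcoef_mul0 m0 mulr0.
    by rewrite fcoef1 => /eqP; rewrite oner_eq0.
  have v00 : cable_layer 0 v 0 0 != 0 by rewrite row2_0.
  apply/orP; case: (full_or_line sL (memL v Nv) v00) => EL; [left; exact/eqP|right].
  apply/existsP; exists (cable_layer 0 v 0 1 / cable_layer 0 v 0 0).
  by rewrite finset.in_setT; apply/eqP.
have [v Nv v0] : exists2 v, N v & fcoef v 0 != 0.
  have [c Lc] : exists c, row2 1 c \in L.
    case/orP: HL => [/eqP->|/existsP[d /andP[_ /eqP->]]]; first by exists 0; rewrite inE.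
    by exists d; rewrite mem_line row2_0 row2_1 mul1r.
  move: Lc; rewrite inE => /asboolP[v Nv Ev]; exists v => //.
  by have := congr1 (fun w : 'rV_2 => w 0 0) Ev; rewrite !row2_0 muln0 => ->; apply: oner_neq0.
apply: (@nakayama _ _ z _ _ (2 * (2 * r * s + r))) => [w|w].
  by apply: Nn; apply/(data_filter cable_leading); exists w.
pose a := fcoef w 0 / fcoef v 0.
exists (a%:A *: v), (Fps (fun i => fcoef (w - a *: v) i.+1)).
split; first exact: module_prod_in.
rewrite !fps_regularE fps_constE; apply: fpsP => i; rewrite fcoefD fcoef_mulX.
case: i => [|i]; first by rewrite addr0 fcoefZ divfK.
by rewrite [fcoef (Fps _) _]/= addrC subrK.
Qed.

End Cable.

(** * The semigroup of the cable *)

Section CableSemigroup.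
Variables (F : finFieldType) (r s : nat) (u : F).
Hypotheses (r_gt0 : (0 < r)%N) (s_gt0 : (0 < s)%N) (co_rs : coprime r s).

Let z := fpsX F.
Let X := z ^+ (2 * r).
Let Y := z ^+ (2 * s) + u *: z ^+ (2 * s).+1.
Let od := cable_leading u r_gt0 s_gt0 co_rs.

(** If [r * u] vanished, all monomials of degree [r * s] would have a leading term
    along [1]. An element of valuation [2 * r * s + 1] involves no monomial of
    smaller degree, because these have distinct degrees, so its coefficient at
    [z ^ (2 * r * s + 1)] would be zero. *)
Lemma cable_not_divisor : u != 0 ->
  (exists2 f, cable_ring r s u f & has_valuation f (2 * r * s + 1)) -> r%:R * u != 0.
Proof.
move=> u0 [f Rf [fN f0]]; apply/eqP => ru.
have [c [N [o Ef]]] := power_series_approx (2 * (r * s).+1) Rf.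
have layer_o l : (l <= r * s)%N -> cable_layer l (z ^+ (2 * (r * s).+1) * o) = 0.
  have : ovanish (Om := (fps F)^o) (@cable_layer F) (r * s).+1 (z ^+ (2 * (r * s).+1) * o).
    by apply/(data_filter od); exists o.
  by move=> H le; apply: H.
have mon a b := monomial_leading od a b.
have layerZ l (k : F) v : cable_layer l (k *: v) = k *: cable_layer l v.
  by rewrite -fps_constE; apply: (data_scale od).
have lead1 a b : cable_layer 0 1 *m (1 ^+ a * shear u ^+ b) = row2 1 (b%:R * u).
  by rewrite expr1n mul1r cable_layer1 shear_pow mulr1 add0r.
have layer_f l : (l <= r * s)%N -> cable_layer l f =
    \sum_(a < N) \sum_(b < N) c a b *: cable_layer l (X ^+ a * Y ^+ b).
  move=> le; rewrite Ef (data_add od) layer_o // addr0 (cO_sum od).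
  by apply: eq_bigr => a _; rewrite (cO_sum od); apply: eq_bigr => b _; rewrite layerZ.
have layer_mon l a b : (l < a * r + b * s)%N -> cable_layer l (X ^+ a * Y ^+ b) = 0.
  by case: (mon a b) => H _ /H.
have layer_top l a b : (a * r + b * s = l)%N ->
    cable_layer l (X ^+ a * Y ^+ b) = row2 1 (b%:R * u).
  by move=> <-; case: (mon a b) => _ ->; rewrite lead1.
have c0 l : (l < r * s)%N -> forall a b : nat, (a < N)%N -> (b < N)%N ->
    (a * r + b * s = l)%N -> c a b = 0.
  elim/ltn_ind: l => l IH lt a0 b0 aN bN E0.
  have E : cable_layer l f = c a0 b0 *: row2 1 (b0%:R * u).
    rewrite layer_f; last exact: ltnW.
    rewrite (bigD1 (Ordinal aN)) //= (bigD1 (Ordinal bN)) //= (layer_top _ _ _ E0).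
    have other (a b : nat) : (a < N)%N -> (b < N)%N -> (a != a0) || (b != b0) ->
        c a b *: cable_layer l (X ^+ a * Y ^+ b) = 0.
      move=> aN' bN' nab; case: (ltngtP (a * r + b * s) l) => [lt'|lt'|El].
      - by rewrite (IH _ lt') ?scale0r //; lia.
      - by rewrite layer_mon ?scaler0.
      - have [] := rep_unique r_gt0 s_gt0 co_rs (etrans El (esym E0)); first by rewrite El.
        by move=> Ea Eb; move: nab; rewrite Ea Eb !eqxx.
    rewrite big1 => [|b bb]; last by apply: other => //; rewrite -val_eqE in bb; rewrite bb orbT.
    rewrite big1 ?addr0 // => a aa; rewrite big1 // => b _; apply: other => //.
    by rewrite -val_eqE in aa; rewrite aa.
  have := congr1 (fun v : 'rV_2 => v 0 0) E; rewrite row2_0 mxE row2_0 mulr1 => <-.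
  by apply: f0; lia.
have := layer_f _ (leqnn _) => /(congr1 (fun v : 'rV_2 => v 0 1)); rewrite row2_1 summxE.
rewrite big1 => [|a _].
  by have -> : (2 * (r * s)).+1 = (2 * r * s + 1)%N by lia.
rewrite summxE big1 // => b _; rewrite mxE.
case: (ltngtP (a * r + b * s) (r * s)) => [lt|lt|E].
- by rewrite (c0 _ lt) ?mul0r.
- by rewrite layer_mon // mxE mulr0.
- rewrite layer_top // row2_1.
  have /dvdnP[k ->] : (r %| b)%N.
    have : (r %| a * r + b * s)%N by rewrite E dvdn_mulr.
    by rewrite (dvdn_addr _ (dvdn_mull a (dvdnn r))) (Gauss_dvdl _ co_rs).
  by rewrite natrM -mulrA ru !mulr0.
Qed.

End CableSemigroup.

(** * The ring of rank two and the two-branch ring *)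

Section PairLayer.
Variable F : finFieldType.

(** The two power series are the coordinates of the two branches, or of a vector of
    rank two. *)
Definition pair_layer i (f : fps F * fps F) : 'rV[F]_2 :=
  row2 (fcoef f.1 i) (fcoef f.2 i).

Definition pair_vanish i (f : fps F * fps F) :=
  forall j, (j < i)%N -> fcoef f.1 j = 0 /\ fcoef f.2 j = 0.

Lemma pair_vanishP i (f : fps F * fps F) :
  (forall j, (j < i)%N -> pair_layer j f = 0) <-> pair_vanish i f.
Proof.
split=> f0 j lt; last by have [f1 f2] := f0 j lt; apply: row2P; rewrite ?row2_0 ?row2_1 mxE.
have /rowP E := f0 j lt; have := E 0; have := E 1.
by rewrite /pair_layer row2_0 row2_1 !mxE.
Qed.

Lemma pair_vanish_div i (f : fps F * fps F) :
  pair_vanish i f <-> exists g : fps F * fps F, f = (fpsX F ^+ i * g.1, fpsX F ^+ i * g.2).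
Proof.
split=> [f0|[g ->] j lt]; last by split; rewrite fcoef_mulXn lt.
have [g1 E1] : exists g, f.1 = fpsX F ^+ i * g by apply: fps_divisible => j /f0[].
have [g2 E2] : exists g, f.2 = fpsX F ^+ i * g by apply: fps_divisible => j /f0[].
by exists (g1, g2); rewrite /= -E1 -E2; case: (f).
Qed.

Lemma pair_layer_mulXn d i (f : fps F * fps F) :
  pair_layer (i + d) (fpsX F ^+ d * f.1, fpsX F ^+ d * f.2) = pair_layer i f.
Proof.
by apply: row2P; rewrite ?row2_0 ?row2_1 fcoef_mulXn ltnNge leq_addl /= addnK.
Qed.

Lemma pair_vanish_mulXn d i (f : fps F * fps F) : pair_vanish i f ->
  pair_vanish (i + d) (fpsX F ^+ d * f.1, fpsX F ^+ d * f.2).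
Proof.
move=> f0 j lt; split; rewrite fcoef_mulXn; case: ltnP => // le.
  by have [] := f0 (j - d)%N; first by lia.
by have [] := f0 (j - d)%N; first by lia.
Qed.

Lemma pair_onto (A : nat -> 'rV[F]_2) : exists f : fps F * fps F, forall i, pair_layer i f = A i.
Proof.
exists (Fps (fun i => A i 0 0), Fps (fun i => A i 0 1)) => i.
by apply: row2P; rewrite ?row2_0 ?row2_1.
Qed.

End PairLayer.

Section RankTwo.
Variables (F : finFieldType) (r s : nat).
Hypotheses (r_gt0 : (0 < r)%N) (s_gt0 : (0 < s)%N) (co_rs : coprime r s).

Let z := fpsX F.
Let Om : lmodType (fps F) := ((fps F)^o * (fps F)^o)%type.

Lemma torus_conductor o : torus_ring (F := F) r s (z ^+ (1 * (2 * r * s)) * o).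
Proof.
pose Fil i (f : fps F) := forall j, (j < i)%N -> fcoef f j = 0.
apply: (@successive_approximation _ _ _ _ _ r s (2 * r * s) 1 Fil) => //.
- by move=> i f f' Hf Hf' j lt; rewrite fcoefB Hf // Hf' // subrr.
- by move=> i c f Hf j lt; rewrite fcoefZ Hf // mulr0.
- by move=> i f Hf j lt; apply: Hf; apply: leq_trans lt _.
- by move=> i f Hf; rewrite mul1n; apply: fps_divisible.
- move=> a b j lt; rewrite -!exprM -exprD -[_ ^+ _]mulr1 fcoef_mulXn.
  by rewrite mulnC [(s * b)%N]mulnC lt.
- move=> i f le Hf.
  case: (gap_or_rep r_gt0 s_gt0 co_rs i) => [[a [b Eab]]|[a [b Eab]]]; last by nia.
  exists (fun a' b' => if (a' == a) && (b' == b) then fcoef f i else 0).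
  rewrite (single_monomial r_gt0 s_gt0 (fun a b => (fpsX F ^+ r) ^+ a * (fpsX F ^+ s) ^+ b) _ Eab).
  move=> j; rewrite ltnS leq_eqVlt fcoefB fcoefZ -!exprM -exprD.
  rewrite mulnC [(s * b)%N]mulnC Eab -[fpsX F ^+ i]mulr1 fcoef_mulXn.
  case/predU1P => [->|lt]; first by rewrite ltnn subnn fcoef1 mulr1 subrr.
  by rewrite lt mulr0 subr0 Hf.
- by rewrite mul1n; apply/fps_divisibleP; exists o.
Qed.

Lemma torus_leading :
  leading_data (Om := Om) z (z ^+ r) (z ^+ s) r s 1 (@pair_layer F) 1 1.
Proof.
have scale_pair (f : fps F) (v : Om) : f *: v = (f * v.1, f * v.2) by [].
have od_shift d i v : ovanish (Om := Om) (@pair_layer F) i v ->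
    ovanish (Om := Om) (@pair_layer F) (i + d) (z ^+ d *: v) /\
    pair_layer (i + d) (z ^+ d *: v) = pair_layer i v *m 1.
  move=> /pair_vanishP v0; rewrite mulmx1 scale_pair; split; last exact: pair_layer_mulXn.
  by apply/pair_vanishP; apply: pair_vanish_mulXn.
split.
- by move=> i f g; apply: row2P; rewrite [RHS]mxE ?row2_0 ?row2_1.
- move=> i c f; rewrite scale_pair !fps_constE.
  by apply: row2P; rewrite [RHS]mxE ?row2_0 ?row2_1.
- exact: pair_onto.
- move=> i v; rewrite mul1n; split=> [/pair_vanishP/pair_vanish_div[g ->]|[g ->]].
    by exists g.
  by apply/pair_vanishP/pair_vanish_div; exists g.
- by [].
- exact: od_shift.
- exact: od_shift.
- move=> i v /pair_vanishP/pair_vanish_div[g ->]; exists (z ^+ i *: (g : Om)).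
    by apply/pair_vanishP/pair_vanish_div; exists g.
  by rewrite !scale_pair /= !mulrA -!exprD addnC.
- by [].
- by exists (z ^+ r.-1); rewrite -exprS prednK.
- by exists (z ^+ s.-1); rewrite -exprS prednK.
- move=> c o /(congr1 (fun f => fcoef f 0)); rewrite fcoef_mulX fcoefZ fcoef1 mulr1.
  by [].
Qed.

(** A module spans the free module of rank two exactly when it does so modulo [z],
    so no line is admissible. *)
Lemma Hmot_rank2E : Hmot_rank2 F r s = full_part F r s 2.
Proof.
transitivity (full_part F r s 2 + line_part F r s 2 *+ #|finset.set0 : {set F}|); last first.
  by rewrite cards0 mulr0n addr0.
apply: (Hmot_lines r_gt0 s_gt0 co_rs torus_leading torus_conductor (unitmx1 _ _) (unitmx1 _ _))
  => [d|N sN Nn L].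
  by rewrite finset.in_set0.
case: (sN) => N0 ND NR.
have sL : subspace L := head_subspace torus_leading sN.
have memL v : N v -> pair_layer 0 v \in L.
  by move=> Nv; rewrite inE; apply/asboolP; exists v.
split=> [NT|/orP[/eqP LT|/existsP[d /andP[]]]]; last by rewrite finset.in_set0.
  apply/orP; left; apply/eqP/setP=> x; rewrite [RHS]finset.in_setT.
  have [v Hv] := pair_onto (fun i => if i == 0%N then x else 0).
  have : module_prod setT N (v : Om) by rewrite NT.
  case=> k [f [m [_ Nm Ev]]]; rewrite -[x](Hv 0%N) Ev (cO_sum torus_leading).
  apply: subspace_sum => // i _.
  have -> : pair_layer 0 (f i *: m i) = fcoef (f i) 0 *: pair_layer 0 (m i).
    by apply: row2P; rewrite [RHS]mxE ?row2_0 ?row2_1 fcoef_mul0.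
  by apply: subspaceZ => //; apply: memL.
apply: (@nakayama _ _ z _ _ (1 * (2 * r * s + r))) => [v|v].
  by apply: Nn; apply/(data_filter torus_leading); exists v.
have : pair_layer 0 v \in L by rewrite LT finset.in_setT.
rewrite inE => /asboolP[v' Nv' Ev'].
have /(data_filter torus_leading)[w Ew] : ovanish (Om := Om) (@pair_layer F) 1 (v - v').
  move=> j; case: j => // _; rewrite (data_add torus_leading) (cON torus_leading).
  by rewrite Ev' subrr.
exists v', w; split; last by rewrite -[z]expr1 -Ew addrC subrK.
by rewrite -[X in module_prod _ _ X]scale1r; apply: module_prod_in.
Qed.

End RankTwo.

Section Link.
Variables (F : finFieldType) (r s : nat) (w : F).
Hypotheses (r_gt0 : (0 < r)%N) (s_gt0 : (0 < s)%N) (co_rs : coprime r s).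
Hypotheses (ws0 : w ^+ s != 0) (ws1 : w ^+ s != 1).

Let z : fps2 F := fps2X F.
Let X : fps2 F := (w *: fpsX F ^+ r, fpsX F ^+ r).
Let Y : fps2 F := (fpsX F ^+ s, fpsX F ^+ s).

Definition branch_scaling : 'M[F]_2 := diag_mx (row2 w 1).

Lemma row2_scaling a b n : row2 a b *m branch_scaling ^+ n = row2 (w ^+ n * a) b.
Proof.
elim: n => [|n IH]; first by rewrite mulmx1 mul1r.
rewrite exprSr -mulmxE mulmxA IH mul_mx_diag.
by apply: row2P; rewrite mxE ?row2_0 ?row2_1 ?mulr1 // mulrC mulrA -exprS.
Qed.

Lemma w_neq0 : w != 0.
Proof. by apply: contraNneq ws0 => ->; rewrite expr0n gtn_eqF. Qed.

Lemma scaling_unit : branch_scaling \in unitmx.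
Proof.
rewrite unitmxE det_diag unitfE; apply/prodf_neq0 => i _; rewrite mxE.
by case: ifP => _; [exact: w_neq0 | exact: oner_neq0].
Qed.

Lemma fps2_pow (a b : fps F) n : ((a, b) : fps2 F) ^+ n = (a ^+ n, b ^+ n).
Proof. by elim: n => [//|n IH]; rewrite !exprS IH. Qed.

Lemma fps2_mulE (f v : fps2 F) : f * v = (f.1 * v.1, f.2 * v.2). Proof. by []. Qed.

Lemma fps2_constE (c : F) (v : fps2 F) : c%:A * v = (c *: v.1, c *: v.2).
Proof. by rewrite mulr_algl. Qed.

Lemma link_leading : leading_data (Om := (fps2 F)^o) z X Y r s 1 (@pair_layer F) branch_scaling 1.
Proof.
have scaleE (f : fps2 F) (v : (fps2 F)^o) : f *: v = (f.1 * v.1, f.2 * v.2) by [].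
split.
- by move=> i f g; apply: row2P; rewrite [RHS]mxE ?row2_0 ?row2_1.
- move=> i c f; rewrite -[_ *: f]/(c%:A * f) fps2_constE.
  by apply: row2P; rewrite [RHS]mxE ?row2_0 ?row2_1.
- exact: pair_onto.
- move=> i v; rewrite mul1n fps2_pow; split=> [/pair_vanishP/pair_vanish_div[g ->]|[g ->]].
    by exists g.
  by apply/pair_vanishP/pair_vanish_div; exists g.
- by [].
- move=> i v /pair_vanishP v0.
  have -> : X *: v = (w *: (fpsX F ^+ r * v.1), fpsX F ^+ r * v.2) :> fps2 F.
    by rewrite scaleE; congr pair; rewrite scalerAl.
  split.
    apply/pair_vanishP => j lt; have [E1 E2] := pair_vanish_mulXn v0 lt.
    split; last exact: E2.
    by rewrite fcoefZ (_ : fcoef (fpsX F ^+ r * v.1) j = 0) ?mulr0.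
  have E := pair_layer_mulXn r i v.
  rewrite [pair_layer i v]row2E -[branch_scaling]expr1 row2_scaling expr1 -E.
  by apply: row2P; rewrite ?row2_0 ?row2_1 ?fcoefZ.
- move=> i v /pair_vanishP v0; rewrite scaleE mulmx1; split; last exact: pair_layer_mulXn.
  by apply/pair_vanishP; apply: pair_vanish_mulXn.
- move=> i v /pair_vanishP/pair_vanish_div[g ->].
  exists ((w^-1 *: (fpsX F ^+ i * g.1), fpsX F ^+ i * g.2) : (fps2 F)^o).
    apply/pair_vanishP/pair_vanish_div; exists (w^-1 *: g.1, g.2).
    by rewrite /= -scalerAr.
  rewrite scaleE /= -scalerAl -scalerAr scalerA mulfV ?w_neq0 // scale1r.
  by rewrite !mulrA -!exprD addnC.
- by rewrite mul1r mulr1.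
- exists (w *: fpsX F ^+ r.-1, fpsX F ^+ r.-1).
  by rewrite fps2_mulE /= -scalerAr -!exprS prednK.
- by exists (fpsX F ^+ s.-1, fpsX F ^+ s.-1); rewrite fps2_mulE /= -!exprS prednK.
- move=> c o /(congr1 (fun f : fps2 F => fcoef f.1 0)); rewrite fcoef_mulX fcoefZ fcoef1 mulr1.
  by [].
Qed.

Lemma link_line_unit d : d != 0 ->
  (col_mx (row2 1 d *m 1 ^+ r) (row2 1 d *m branch_scaling ^+ s) : 'M_(1 + 1, 2)) \in unitmx.
Proof.
move=> d0; rewrite expr1n mulmx1 row2_scaling; apply: col_row2_unit.
by rewrite mul1r mulr1 -{1}[d]mulr1 -mulrBr mulf_neq0 // subr_eq0 eq_sym.
Qed.

Lemma link_layer1 : pair_layer 0 (1 : fps2 F) = row2 1 1.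
Proof. by []. Qed.

(** A module spans the ring of the two branches when some element is a unit on each
    of them. Hence the admissible lines are the [#|F| - 1] ones other than the
    coordinate axes. *)
Lemma Hmot_linkE : Hmot_link r s w = full_part F r s 1 + line_part F r s 1 *+ #|F|.-1.
Proof.
have cond := conductor_rank_one r_gt0 s_gt0 co_rs link_leading scaling_unit (unitmx1 _ _).
rewrite link_layer1 in cond; have {}cond := cond (link_line_unit (oner_neq0 _)).
rewrite -(cardsC1 (0 : F)).
apply: (Hmot_lines r_gt0 s_gt0 co_rs link_leading cond scaling_unit (unitmx1 _ _)) => [d|N sN Nn L].
  by rewrite finset.in_setC1; apply: link_line_unit.
case: (sN) => N0 ND NR.
have sL : subspace L := head_subspace link_leading sN.
have memL v : N v -> pair_layer 0 v \in L.
  by move=> Nv; rewrite inE; apply/asboolP; exists v.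
split=> [NT|HL].
  have [k [f [m [_ Nm E1]]]] : module_prod setT N (1 : (fps2 F)^o) by rewrite NT.
  have E0 : row2 1 1 = \sum_i pair_layer 0 (f i *: m i).
    by rewrite -(cO_sum link_leading) -E1.
  have [i i0] : exists i, pair_layer 0 (m i) 0 0 != 0.
    apply: contrapT => H; have := congr1 (fun v : 'rV_2 => v 0 0) E0.
    rewrite row2_0 summxE big1 => [/eqP|i _]; first by rewrite oner_eq0.
    rewrite row2_0 fcoef_mul0; have [->|m0] := eqVneq (fcoef (m i).1 0) 0; first by rewrite mulr0.
    by case: H; exists i; rewrite row2_0.
  have [j j0] : exists i, pair_layer 0 (m i) 0 1 != 0.
    apply: contrapT => H; have := congr1 (fun v : 'rV_2 => v 0 1) E0.
    rewrite row2_1 summxE big1 => [/eqP|j _]; first by rewrite oner_eq0.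
    rewrite row2_1 fcoef_mul0; have [->|m0] := eqVneq (fcoef (m j).2 0) 0; first by rewrite mulr0.
    by case: H; exists j; rewrite row2_1.
  apply/orP; case: (full_or_line sL (memL _ (Nm i)) i0) => EL; [left; exact/eqP|right].
  apply/existsP; exists (pair_layer 0 (m i) 0 1 / pair_layer 0 (m i) 0 0).
  apply/andP; split; last exact/eqP.
  rewrite finset.in_setC1; apply: contraNneq j0 => d0.
  have := memL _ (Nm j); rewrite EL d0 mem_line => /eqP->.
  by rewrite mulr0.
have [d d0 Ld] : exists2 d, d != 0 & row2 1 d \in L.
  case/orP: HL => [/eqP->|/existsP[d /andP[d0 /eqP->]]].
    by exists 1; rewrite ?oner_neq0 ?finset.in_setT.
  by exists d; rewrite ?mem_line ?row2_0 ?row2_1 ?mul1r // -finset.in_setC1.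
move: Ld; rewrite inE => /asboolP[v Nv Ev].
apply: (@nakayama _ _ z _ _ (1 * (2 * r * s + r))) => [x|x].
  by apply: Nn; apply/(data_filter link_leading); exists x.
pose f : fps2 F := ((fcoef x.1 0)%:A, (fcoef x.2 0 / d)%:A).
have /(data_filter link_leading)[y Ey] : ovanish (Om := (fps2 F)^o) (@pair_layer F) 1 (x - f *: v).
  move=> j; case: j => // _; rewrite (data_add link_leading) (cON link_leading).
  have v1 : fcoef v.1 0 = 1 by have := congr1 (fun v : 'rV_2 => v 0 0) Ev; rewrite !row2_0.
  have v2 : fcoef v.2 0 = d by have := congr1 (fun v : 'rV_2 => v 0 1) Ev; rewrite !row2_1.
  have -> : pair_layer 0 (f *: v) = pair_layer 0 x; last by rewrite subrr.
  have f1 : fcoef f.1 0 = fcoef x.1 0 by rewrite [LHS](fcoefZ _ 1) fcoef1 mulr1.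
  have f2 : fcoef f.2 0 = fcoef x.2 0 / d by rewrite [LHS](fcoefZ _ 1) fcoef1 mulr1.
  apply: row2P; rewrite ?row2_0 ?row2_1 fcoef_mul0.
    by rewrite v1 f1 mulr1.
  by rewrite v2 f2 divfK.
exists (f *: v), y; split; last by rewrite -[z]expr1 -Ey addrC subrK.
exact: module_prod_in.
Qed.

End Link.

(** Modules with full reduction have at least two generators, so the products of
    the two normalizations differ by the factor of index [1]. *)
Lemma full_part_rank2 (F : finFieldType) (r s : nat) :
  (1 + varA * qpol F) * full_part F r s 2 = full_part F r s 1.
Proof.
rewrite /full_part /quotient_sum mulr_sumr; apply: eq_bigr => U _.
rewrite mulrnAr; congr (_ *+ _); rewrite /weight mulrCA; congr (_ * _).
by rewrite [RHS]big_ltn ?addn2 // expr1.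
Qed.

Theorem proposition7p1 (F : finFieldType) (r s : nat) (u w : F)
    (hr : (0 < r)%N) (hs : (0 < s)%N) (hrs : coprime r s)
    (hu : u != 0)
    (hsg : valuation_semigroup (cable_ring r s u) =
           generated_semigroup3 (2 * r) (2 * s) (2 * r * s + 1))
    (hw0 : w ^+ s != 0) (hw1 : w ^+ s != 1) :
  (1 + varA * qpol F) * Hmot_rank2 F r s + (qpol F - 1) * Hmot_cable r s u
  = qpol F * Hmot_link r s w.
Proof.
have ru : r%:R * u != 0.
  apply: (cable_not_divisor (s := s)) => //.
  have : valuation_semigroup (cable_ring r s u) (2 * r * s + 1)%N.
    by rewrite hsg; exists 0%N, 0%N, 1%N; rewrite mul1n.
  by [].
rewrite Hmot_rank2E // full_part_rank2 Hmot_cableE // Hmot_linkE //.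
have -> : line_part F r s 1 *+ #|F| = qpol F * line_part F r s 1.
  by rewrite mulr_natl.
have -> : line_part F r s 1 *+ #|F|.-1 = qpol F * line_part F r s 1 - line_part F r s 1.
  rewrite mulr_natl -[X in _ *+ X - _]prednK ?mulrSr ?addrK //.
  exact: ltnW (card_field_gt1 F).
ring.
Qed.
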